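(* Let $G'$ be a snark and let $E=(U,V)$ be an edge of $G'$. Let $G_0' := G'-\{U,V\}$. Let $T_{-2},T_2$ be the vertices of $G_0'$ such that $(T_i,U)$, $i\in\{-2,2\}$, are edges of $G'$, and let $W_{-2},W_2$ be the vertices of $G_0'$ such that $(V,W_i)$, $i\in\{-2,2\}$, are edges of $G'$. Let $G^*$ be a snark that is disjoint from $G'$, and let $u$ and $v$ be distinct vertices of $G^*$ that are not adjacent to each other in $G^*$. Let $u_i$, $i\in\{-1,0,1\}$, be the three vertices of $G^*$ such that $(u,u_i)$ is an edge of $G^*$, and let $v_i$, $i\in\{-1,0,1\}$, be the three vertices of $G^*$ such that $(v_i,v)$ is an edge of $G^*$. Let $G_0^* := G^*-\{u,v\}$. Let $G$ be the simple cubic graph that consists of $G_0'$, $G_0^*$, six new vertices $T_i$ and $W_i$, $i\in\{-1,0,1\}$, and the fourteen new edges $$(T_i,T_{i+1}),\ (W_i,W_{i+1})\quad (i\in\{-2,-1,0,1\}),\qquad (T_i,u_i),\ (v_i,W_i)\quad (i\in\{-1,0,1\}).$$ Suppose $e$ is an edge of $G_0^*$. Then $e$ is an edge of $G$, and $$\psi(G,e) = 2\cdot\psi(G^*,e)\cdot\psi(G',E).$$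
   Context: All graphs are undirected and nonempty. A graph is simple if it has only finitely many vertices, has no loops and no multiple edges, and is connected. A graph is cubic if every vertex is connected to exactly three edges. Two graphs (or two cycles in a graph) are disjoint if they have no vertex in common. For a set $Q$ of vertices of a graph $G$, $G-Q$ is the graph obtained from $G$ by deleting every vertex in $Q$ and every edge connected to at least one vertex in $Q$ (all other vertices are kept). For a set $S$ of edges of $G$, $G-S$ is obtained from $G$ by deleting the edges in $S$ (but no vertices). Two edges are adjacent if they are connected to the same vertex. An edge-3-coloring of a cubic graph is a function from its edge set to a fixed set $\{a,b,c\}$ of three colors such that adjacent edges get different colors. A 3-edge-decomposition of a cubic graph $H$ is a partition of the edge set of $H$ into three (unordered, unlabeled) classes such that no two adjacent edges are in the same class; $ED(H)$ denotes the set of all 3-edge-decompositions of $H$. (Thus the number of edge-3-colorings of $H$ is $6\cdot\mathrm{card}\,ED(H)$.) The girth of a graph having a cycle is the smallest number of vertices of a cycle in it. A simple graph $G$ having at least one pair of disjoint cycles is cyclically $n$-edge-connected ($n\ge 2$) if, whenever $C_1,C_2$ are disjoint cycles in $G$ and $S$ is a set of at most $n-1$ edges of $G$ containing none of the edges of $C_1$ and $C_2$, there is a path in $G-S$ from a vertex of $C_1$ to a vertex of $C_2$. A snark is a simple cubic graph that has girth at least $5$, is cyclically $4$-edge-connected, and has no edge-3-coloring. For a snark $G$ and an edge $e=(x,y)$ of $G$, let $t_1,t_2$ be the two vertices other than $y$ adjacent to $x$, and $w_1,w_2$ the two vertices other than $x$ adjacent to $y$ (these four vertices are distinct, and neither $(t_1,t_2)$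 nor $(w_1,w_2)$ is an edge of $G$). Then $G_e$ denotes the simple cubic graph consisting of $G-\{x,y\}$ together with the two new edges $(t_1,t_2)$ and $(w_1,w_2)$. The Kászonyi number of $G$ and $e$ is $$\psi(G,e) := \tfrac13\,\mathrm{card}\,ED(G_e),$$ which is known to be a nonnegative integer (it is $0$ if $G_e$ has no edge-3-coloring); equivalently, $G_e$ has exactly $18\,\psi(G,e)$ edge-3-colorings. In the construction in the claim, one of the vertices $u_i$ may coincide with one of the vertices $v_j$; any further coincidences among these vertices are excluded because $G^*$ has girth at least $5$. It is well known that the graph $G$ constructed in the claim is a snark, so that $\psi(G,e)$ is defined. *)

(* Defs.v *)
From HB Require Import structures.
From mathcomp Require Import all_boot all_order all_algebra.

Set Implicit Arguments.
Unset Strict Implicit.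
Unset Printing Implicit Defensive.

(* Finite undirected graphs without loops and multiple edges. Nonemptiness and
   connectedness are part of [simple]. *)
Record graph := Graph {
  vertex :> finType;
  adj : rel vertex;
  adj_sym : symmetric adj;
  adj_irr : irreflexive adj
}.

Arguments adj {g} : rename.

(* An edge is the set of its two ends. *)
Definition edges (G : graph) : {set {set G}} :=
  [set [set p.1; p.2] | p in [pred p : G * G | adj p.1 p.2]].

Definition adjacent_edges (G : graph) (e f : {set G}) : bool :=
  (e != f) && ~~ [disjoint e & f].

Definition simple (G : graph) : Prop :=
  0 < #|G| /\ forall x y : G, connect adj x y.

Definition cubic (G : graph) : Prop :=
  forall x : G, #|[set y | adj x y]| = 3.

Section VertexDeletion.
Variables (G : graph) (Q : {set G}).

Definition del_vertices_adj : rel {x : G | x \notin Q} :=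
  fun a b => adj (val a) (val b).

Fact del_vertices_sym : symmetric del_vertices_adj.
Proof. by move=> a b; rewrite /del_vertices_adj adj_sym. Qed.

Fact del_vertices_irr : irreflexive del_vertices_adj.
Proof. by move=> a; rewrite /del_vertices_adj adj_irr. Qed.

Definition del_vertices : graph := Graph del_vertices_sym del_vertices_irr.

End VertexDeletion.

Section EdgeDeletion.
Variables (G : graph) (S : {set {set G}}).

Definition del_edges_adj : rel G :=
  fun a b => adj a b && ([set a; b] \notin S).

Fact del_edges_sym : symmetric del_edges_adj.
Proof. by move=> a b; rewrite /del_edges_adj adj_sym setUC. Qed.

Fact del_edges_irr : irreflexive del_edges_adj.
Proof. by move=> a; rewrite /del_edges_adj adj_irr. Qed.

Definition del_edges : graph := Graph del_edges_sym del_edges_irr.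

End EdgeDeletion.

Definition edge (G : graph) : finType := {e : {set G} | e \in edges G}.

Definition edge_3_coloring (G : graph) (f : edge G -> 'I_3) : Prop :=
  forall d e : edge G, adjacent_edges (val d) (val e) -> f d <> f e.

(* [partition] requires nonempty blocks; this excludes nothing on a nonempty
   cubic graph, where each of the three classes covers every vertex. *)
Definition ED (G : graph) : {set {set {set {set G}}}} :=
  [set P | [&& partition P (edges G), #|P| == 3 &
      [forall B in P, forall d in B, forall e in B, ~~ adjacent_edges d e]]].

Definition is_cycle (G : graph) (c : seq G) : bool :=
  (2 < size c) && ucycleb adj c.

Definition cycle_edges (G : graph) (c : seq G) : {set {set G}} :=
  [set [set x; next c x] | x in c].

Definition is_girth (G : graph) (g : nat) : Prop :=
  (exists2 c : seq G, is_cycle c & size c = g) /\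
  (forall c : seq G, is_cycle c -> g <= size c).

Definition cyclically_edge_connected (n : nat) (G : graph) : Prop :=
  [/\ simple G,
      exists c1 c2 : seq G,
        [/\ is_cycle c1, is_cycle c2 & [disjoint c1 & c2]] &
      forall (c1 c2 : seq G) (S : {set {set G}}),
        is_cycle c1 -> is_cycle c2 -> [disjoint c1 & c2] ->
        S \subset edges G -> #|S| <= n.-1 ->
        [disjoint S & cycle_edges c1] -> [disjoint S & cycle_edges c2] ->
        exists x y : G,
          [/\ x \in c1, y \in c2 & connect (@adj (del_edges S)) x y]].

Definition snark (G : graph) : Prop :=
  [/\ simple G,
      cubic G,
      exists2 g, is_girth G g & 5 <= g,
      cyclically_edge_connected 4 G &
      ~ exists f : edge G -> 'I_3, edge_3_coloring f].

(* G_e: delete both ends of e and, for each end z of e, join the remaining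
   neighbours of z to each other. In a cubic graph, an end of e has exactly two
   remaining neighbours. *)
Section EdgeReduction.
Variables (G : graph) (e : {set G}).

Definition edge_reduction_adj : rel (del_vertices e) :=
  fun a b => adj a b ||
    (a != b) && [exists z in e, adj z (val a) && adj z (val b)].

Fact edge_reduction_sym : symmetric edge_reduction_adj.
Proof.
move=> a b; rewrite /edge_reduction_adj adj_sym eq_sym.
by under eq_existsb => z do rewrite [X in _ && X]andbC.
Qed.

Fact edge_reduction_irr : irreflexive edge_reduction_adj.
Proof. by move=> a; rewrite /edge_reduction_adj adj_irr eqxx. Qed.

Definition edge_reduction : graph :=
  Graph edge_reduction_sym edge_reduction_irr.

End EdgeReduction.

Definition kaszonyi (G : graph) (e : {set G}) : rat :=
  (#|ED (edge_reduction e)|%:R / 3%:R)%R.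

(* The glued graph. Its vertex type is the disjoint sum of the vertices of
   G' - {U, V}, those of G* - {u, v}, and two copies of 'I_3 for the new
   vertices T_i and W_i, i = -1, 0, 1. All indices in {-1, 0, 1} are shifted by
   one to 0, 1, 2; Tm2, T2, Wm2, W2 are the vertices of index -2 and 2. *)
Section Glue.
Variables (G' Gs : graph) (U V : G') (u v : Gs).

Let G0' : graph := del_vertices [set U; V].
Let G0s : graph := del_vertices [set u; v].

Variables (Tm2 T2 Wm2 W2 : G0') (u_ v_ : 'I_3 -> Gs).

Definition glue_vertex : finType := ((G0' + G0s) + ('I_3 + 'I_3))%type.

Definition in_prime (a : G0') : glue_vertex := inl (inl a).
Definition in_star (a : G0s) : glue_vertex := inl (inr a).
Definition newT (i : 'I_3) : glue_vertex := inr (inl i).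
Definition newW (i : 'I_3) : glue_vertex := inr (inr i).

Definition glue_arc (p q : glue_vertex) : bool :=
  match p, q with
  | inl (inl a), inl (inl b) => adj a b
  | inl (inr a), inl (inr b) => adj a b
  | inl (inl a), inr (inl i) =>
      (a == Tm2) && (i == 0 :> nat) || (a == T2) && (i == 2 :> nat)
  | inl (inl a), inr (inr i) =>
      (a == Wm2) && (i == 0 :> nat) || (a == W2) && (i == 2 :> nat)
  | inr (inl i), inr (inl j) => i.+1 == j
  | inr (inr i), inr (inr j) => i.+1 == j
  | inr (inl i), inl (inr a) => val a == u_ i
  | inr (inr i), inl (inr a) => val a == v_ i
  | _, _ => false
  end.

Definition glue_adj : rel glue_vertex :=
  fun p q => glue_arc p q || glue_arc q p.

Fact glue_sym : symmetric glue_adj.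
Proof. by move=> p q; rewrite /glue_adj orbC. Qed.

Fact glue_irr : irreflexive glue_adj.
Proof.
move=> [[a|a]|[i|i]]; rewrite /glue_adj orbb /glue_arc ?adj_irr //.
  by rewrite gtn_eqF.
by rewrite gtn_eqF.
Qed.

Definition glue : graph := Graph glue_sym glue_irr.

End Glue.

Arguments glue {G' Gs} U V u v Tm2 T2 Wm2 W2 u_ v_.
Arguments in_star {G' Gs} U V {u v} a.

(* Main.v *)
(** Colour with the nonzero elements of [Z/2 x Z/2]: on a cubic graph the
    3-edge-colourings are the nowhere-zero flows, and there are six for each
    3-edge-decomposition. Flows with prescribed boundary demands can be counted
    by removing edges one at a time and summing over the removed colour. A vertex
    of degree 2 forces its two edges to share a colour, so [G_e] has as many
    colourings as [G] with the edge [e] removed has flows.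

    For the four-pole [G' - {U, V}] with dangling colours [t1, t2] at the
    [T]-side and [w1, w2] at the [W]-side, parity and the uncolourability of [G']
    force [t1 = t2] and [w1 = w2]. A Kempe chain issuing from the [T]-side must
    then end on the [T]-side, so switching it shows that the number [k] of
    colourings is the same for all nine pairs [(t, w)]; thus the reduction of [G']
    has [9 k] colourings. Three colours [p, q, r] dangling from the path
    [T_{-1}, T_0, T_1] extend to the path with equal end colours iff
    [p + q + r = 0], and then uniquely, so each path behaves like a cubic
    vertex [u] or [v]: the reduction of [G] has [k] times as many colourings as
    that of [G*]. *)

Require Import Defs.
From HB Require Import structures.
From mathcomp Require Import all_boot all_order all_algebra ring.

Set Implicit Arguments.
Unset Strict Implicit.
Unset Printing Implicit Defensive.

Import GRing.Theory.

(** * Flows with demands *)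

Notation color := (bool * bool)%type.

Lemma addcc (a : color) : (a + a = 0)%R.
Proof. by case: a => [[] []]. Qed.

Lemma oppc (a : color) : (- a = a)%R.
Proof. by case: a => [[] []]. Qed.

Lemma addc_eq0 (a b : color) : (a + b == 0)%R = (a == b).
Proof. by case: a b => [[] []] [[] []]. Qed.

(* Sums over nonzero colours are written out so that closed ones compute. *)
Definition nzsum (F : color -> nat) : nat :=
  F (true, false) + F (false, true) + F (true, true).

Lemma nzsumE F : nzsum F = \sum_(t : color | t != 0%R) F t.
Proof.
rewrite (bigD1 (true, false)) //= (bigD1 (false, true)) //=.
rewrite (bigD1 (true, true)) //= big1 ?addn0 ?addnA //.
by move=> [[] []].
Qed.

Lemma eq_nzsum (F F' : color -> nat) :
  (forall t, t != 0%R -> F t = F' t) -> nzsum F = nzsum F'.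
Proof. by move=> eqF; rewrite !nzsumE; apply: eq_bigr. Qed.

Lemma nzsum_eq0 (F : color -> nat) t : nzsum F = 0 -> t != 0%R -> F t = 0.
Proof.
move=> /eqP; rewrite nzsumE sum_nat_eq0 => /forallP/(_ t)/implyP Ft nz_t.
exact/eqP/Ft.
Qed.

Lemma nzsum_mulr F k : nzsum (fun t => F t * k) = nzsum F * k.
Proof. by rewrite !nzsumE big_distrl. Qed.

Lemma nzsum_mull F k : nzsum (fun t => k * F t) = k * nzsum F.
Proof. by rewrite !nzsumE big_distrr. Qed.

(** Collapses a double sum over two colours that are forced to agree, as happens at a vertex of
    degree two. *)
Lemma nzsum_diag (F : color -> color -> nat) :
  (forall s t, s != t -> F s t = 0) ->
  nzsum (fun s => nzsum (F s)) = nzsum (fun s => F s s).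
Proof.
move=> F0; apply: eq_nzsum => s nz_s.
rewrite nzsumE (bigD1 s) //= big1 ?addn0 // => t /andP[_ ts].
by rewrite F0 // eq_sym.
Qed.

Lemma set_ind (T : finType) (P : {set T} -> Prop) :
  P set0 -> (forall x (A : {set T}), x \notin A -> P A -> P (x |: A)) ->
    forall A, P A.
Proof.
move=> P0 PU A; have [n] := ubnP #|A|; elim: n A => // n IHn A leAn.
have [->//|[x xA]] := set_0Vmem A.
rewrite -(setD1K xA); apply: PU; first by rewrite !inE eqxx.
by apply: IHn; move: leAn; rewrite (cardsD1 x) xA.
Qed.

Section Flows.
Variable T : finType.
Implicit Types (E : {set {set T}}) (S : {set T}) (d : T -> color).
Implicit Types (c : {ffun {set T} -> color}).

(** Colours are given to all subsets of [T], and the support is required to be exactly [E]. Flows on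
    different edge sets thus live in one type, so edges can be added and removed without changing
    the domain. *)
Definition flows E d : {set {ffun {set T} -> color}} :=
  [set c : {ffun {set T} -> color} | [forall S, (c S != 0%R) == (S \in E)] &&
     [forall x, (\sum_(S : {set T} | x \in S) c S)%R == d x]].

Definition nflows E d : nat := #|flows E d|.

Lemma flowsP E d c :
  reflect ((forall S, (c S != 0%R) = (S \in E)) /\
           forall x, (\sum_(S : {set T} | x \in S) c S)%R = d x)
          (c \in flows E d).
Proof.
rewrite inE; apply: (iffP andP) => -[].
  by move=> /forallP cE /forallP cd; split=> z;
    [apply: (eqP (cE z))|apply: (eqP (cd z))].
by move=> cE cd; split; apply/forallP => z; apply/eqP.
Qed.

Lemma eq_nflows E d d' : d =1 d' -> nflows E d = nflows E d'.
Proof.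
move=> eqd; apply: eq_card => c.
by apply/flowsP/flowsP => -[cE cd]; split=> // x; rewrite cd.
Qed.

Lemma nflows0 d : nflows set0 d = [forall x, d x == 0%R].
Proof.
case: forallP => [d0|nd0] /=.
  apply/eqP/cards1P; exists [ffun=> 0%R]; apply/setP => c; rewrite in_set1.
  apply/flowsP/eqP => [[cE _]|->].
    by apply/ffunP => S; apply/eqP; rewrite ffunE -[_ == _]negbK cE inE.
  split=> [S|x]; first by rewrite ffunE eqxx inE.
  by rewrite big1 => [|S _]; rewrite ?ffunE // (eqP (d0 x)).
apply/eqP; rewrite cards_eq0 -subset0; apply/subsetP => c /flowsP[cE cd].
case: nd0 => x; rewrite -cd big1 // => S _; apply/eqP.
by rewrite -[_ == _]negbK cE inE.
Qed.

Lemma nflows_isolated E d x :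
  (forall S, S \in E -> x \notin S) -> d x != 0%R -> nflows E d = 0.
Proof.
move=> Ex dx; apply/eqP; rewrite cards_eq0 -subset0; apply/subsetP => c.
case/flowsP => cE cd; case/eqP: dx; rewrite -cd big1 // => S xS.
by apply/eqP; rewrite -[_ == _]negbK cE; apply/negP => /Ex; rewrite xS.
Qed.

(** The demand left once [S] has been taken away with colour [t]; the sign does not matter because
    every colour is its own opposite. *)
Definition shift d S (t : color) : T -> color :=
  fun x => (d x + t *+ (x \in S))%R.

(** The basic recursion: flows are sorted by the colour of [S0], and forgetting that colour moves it
    into the demand at the ends of [S0]. *)
Lemma nflowsU1 E S0 d : S0 \notin E ->
  nflows (S0 |: E) d = nzsum (fun t => nflows E (shift d S0 t)).
Proof.
move=> S0E; rewrite nzsumE /nflows -sum1_card.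
rewrite (partition_big (fun c => c S0) [pred t | t != 0%R]) /=; last first.
  by move=> c /flowsP[-> _]; rewrite setU11.
apply: eq_bigr => t nz_t; rewrite sum1dep_card.
(* [put s] recolours [S0] with [s]. [put t] carries the flows on [E] with shifted demand injectively
   onto the flows that give [S0] the colour [t]; [put 0] undoes it. *)
pose put s c : {ffun {set T} -> color} := [ffun S => if S == S0 then s else c S].
have sum_put s c x : (\sum_(S : {set T} | x \in S) put s c S =
    s *+ (x \in S0) + \sum_(S : {set T} | x \in S) c S - c S0 *+ (x \in S0))%R.
  have [xS0|xS0] := boolP (x \in S0); last first.
    rewrite !mulr0n add0r subr0; apply: eq_bigr => S xS; rewrite ffunE.
    by case: eqP xS0 => // <-; rewrite xS.
  rewrite (bigD1 S0) // [in RHS](bigD1 S0) //= ffunE eqxx !mulr1n.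
  rewrite addrAC -!addrA [(- _ + _)%R]addrA addNr add0r.
  by congr (_ + _)%R; apply: eq_bigr => S /andP[_ /negPf]; rewrite ffunE => ->.
have putK s c : put (c S0) (put s c) = c.
  by apply/ffunP => S; rewrite !ffunE; case: eqP => [->|].
have putK' s c : put s c S0 = s by rewrite ffunE eqxx.
have put_inj : {in flows E (shift d S0 t) &, injective (put t)}.
  move=> c1 c2 /flowsP[c1E _] /flowsP[c2E _] eqc.
  have c10 : c1 S0 = 0%R by apply/eqP; rewrite -[_ == _]negbK c1E.
  have c20 : c2 S0 = 0%R by apply/eqP; rewrite -[_ == _]negbK c2E.
  by rewrite -[c1](putK t) -[c2](putK t) eqc c10 c20.
rewrite -(card_in_imset put_inj); apply: eq_card => c; rewrite inE.
apply/idP/imsetP => [/andP[/flowsP[cE cd] /eqP ct]|[c' /flowsP[cE cd] ->]].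
  exists (put 0%R c); last by rewrite -ct putK.
  apply/flowsP; split=> [S|x].
    rewrite ffunE; have [->|SS0] := eqVneq S S0.
      by rewrite eqxx (negPf S0E).
    by rewrite cE !inE (negPf SS0).
  by rewrite sum_put mul0rn add0r cd ct oppc.
rewrite putK' eqxx andbT; apply/flowsP; split=> [S|x].
  by rewrite ffunE !inE; have [_|_] := eqVneq S S0; rewrite ?cE.
have c'0 : c' S0 = 0%R by apply/eqP; rewrite -[_ == _]negbK cE.
by rewrite sum_put c'0 mul0rn subr0 cd addrC -addrA addcc addr0.
Qed.

End Flows.

Lemma imset_setU1 (X Y : finType) (f : X -> Y) (x : X) (A : {set X}) :
  f @: (x |: A) = f x |: f @: A.
Proof. by rewrite imsetU imset_set1. Qed.

(** The image edges miss every vertex outside the range of [j], so a nonzero demand there cannot be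
    met. The equality follows by adding one edge at a time. *)
Lemma nflows_imset (X Y : finType) (j : X -> Y) (E : {set {set X}}) d :
  injective j ->
  nflows [set j @: S | S : {set X} in E] d =
  nflows E (d \o j) * [forall y, (y \notin codom j) ==> (d y == 0%R)].
Proof.
move=> injj; elim/set_ind: E d => [|S E SE IHE] d.
  rewrite imset0 !nflows0 mulnb; congr (nat_of_bool _).
  apply/forallP/andP => [d0|[/forallP d0 /forallP d0'] y].
    by split; apply/forallP => y; rewrite ?d0 ?implybT //; apply: d0.
  have [/codomP[x ->]|/(implyP (d0' y))//] := boolP (y \in codom j).
  exact: d0.
rewrite imset_setU1 !nflowsU1 ?mem_imset //; last exact: imset_inj.
rewrite -nzsum_mulr; apply: eq_nzsum => t _; rewrite IHE.
congr (_ * nat_of_bool _).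
  by apply: eq_nflows => x; rewrite /= /shift mem_imset.
apply: eq_forallb => y; have [//|/= yj] := boolP (y \in codom j).
rewrite /shift (_ : y \in _ = false) ?addr0 //.
by apply: contraNF yj => /imsetP[x _ ->]; apply: codom_f.
Qed.

(** Flows on a disjoint union are pairs of flows. The empty set is kept out of [E] because its
    images under [inl] and [inr] coincide. *)
Lemma nflows_sum (X Y : finType) (E : {set {set X}}) (F : {set {set Y}}) d :
  set0 \notin E ->
  nflows ([set inl @: S | S : {set X} in E] :|:
          [set inr @: S | S : {set Y} in F]) d =
  nflows E (d \o inl) * nflows F (d \o inr).
Proof.
elim/set_ind: E d => [|S E SE IHE] d E0.
  rewrite imset0 set0U nflows_imset ?nflows0 1?mulnC; last by move=> ? ? [].
  congr (nat_of_bool _ * _); apply/forallP/forallP => d0 x.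
    by apply: (implyP (d0 (inl x))); apply/negP => /codomP[].
  apply/implyP; case: x => [x _|y]; first exact: d0.
  by rewrite codom_f.
have injl : injective (@inl X Y) by move=> ? ? [].
move: E0; rewrite !inE negb_or eq_sym => /andP[S0 E0].
rewrite imset_setU1 -setUA !nflowsU1 //; last first.
  rewrite inE mem_imset ?(negPf SE) /=; last exact: imset_inj.
  apply/imsetP => -[S' _ /setP eqS]; case/set0Pn: S0 => x xS.
  by have := eqS (inl x); rewrite mem_imset // xS => /esym/imsetP[].
rewrite -nzsum_mulr; apply: eq_nzsum => t _; rewrite IHE //.
congr (_ * _); apply: eq_nflows => x; rewrite /= /shift ?mem_imset //.
by rewrite (_ : inr x \in _ = false) ?addr0 //; apply/imsetP => -[].
Qed.

Section Handshake.
Variables (T : finType) (E : {set {set T}}).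
Hypothesis E2 : forall S, S \in E -> #|S| = 2.

(** Double counting: an edge contributes its colour once for each of its ends in [R]. *)
Lemma sum_demand d c (R : {set T}) : c \in flows E d ->
  (\sum_(x in R) d x = \sum_(S in E) c S *+ #|S :&: R|)%R.
Proof.
case/flowsP => cE cd.
under eq_bigr do rewrite -cd.
rewrite (exchange_big_dep xpredT) //= [LHS](bigID (mem E)) /=.
rewrite [X in (_ + X)%R]big1 ?addr0 => [|S SE]; last first.
  apply: big1 => x _; apply/eqP; rewrite -[_ == _]negbK cE; exact: SE.
apply: eq_bigr => S _; rewrite sumr_const; congr (_ *+ _)%R.
by apply: eq_card => x; rewrite !inE andbC.
Qed.

Lemma handshake d : nflows E d != 0 -> (\sum_x d x = 0)%R.
Proof.
rewrite cards_eq0 => /set0Pn[c cf].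
rewrite (eq_bigl (mem [set: T])) => [|x]; last by rewrite /= inE.
by rewrite (sum_demand _ cf) big1 // => S /E2; rewrite setIT => ->;
  rewrite mulr2n addcc.
Qed.

End Handshake.

(** * Edge sets of graphs *)

Definition star (T : finType) (E : {set {set T}}) (x : T) : {set {set T}} :=
  [set S in E | x \in S].

Definition degree (T : finType) (E : {set {set T}}) (x : T) : nat :=
  #|star E x|.

Lemma degreeU1 (T : finType) (E : {set {set T}}) S x : S \notin E ->
  degree (S |: E) x = (x \in S) + degree E x.
Proof.
move=> SE; rewrite /degree (cardsD1 S) !inE eqxx /=; congr (_ + _).
apply: eq_card => S'; rewrite !inE; case: eqVneq => [->|_] //=.
by rewrite (negPf SE).
Qed.

Lemma degree_imset (X Y : finType) (j : X -> Y) (E : {set {set X}}) x :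
  injective j -> degree [set j @: S | S : {set X} in E] (j x) = degree E x.
Proof.
move=> injj; rewrite /degree -[RHS](card_imset _ (imset_inj injj)).
apply: eq_card => S; rewrite !inE; apply/andP/imsetP.
  case=> /imsetP[S' S'E ->]; rewrite mem_imset // => xS'.
  by exists S'; rewrite ?inE ?S'E.
by case=> S'; rewrite inE => /andP[S'E xS'] ->; rewrite !mem_imset //;
  apply: imset_inj.
Qed.

Lemma degree_isolated (T : finType) (E : {set {set T}}) x :
  (forall S, S \in E -> x \notin S) -> degree E x = 0.
Proof.
move=> Ex; apply/eqP; rewrite cards_eq0 -subset0; apply/subsetP => S.
by rewrite inE => /andP[/Ex/negPf->].
Qed.

Lemma eq_set2 (T : finType) (a b c d : T) :
  ([set a; b] == [set c; d]) =
  (a == c) && (b == d) || (a == d) && (b == c).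
Proof.
apply/eqP/idP => [/setP eqS|]; last first.
  by case/orP=> /andP[/eqP-> /eqP->] //; rewrite setUC.
move: (eqS a) (eqS b) (eqS c) (eqS d); rewrite !inE !eqxx /= !orbT.
rewrite ![c == _]eq_sym ![d == _]eq_sym.
by do 4 case: eqP => //= _.
Qed.

Section Edges.
Variable G : graph.
Implicit Types (x y : G) (S : {set G}).

Lemma edgesP S :
  reflect (exists x y, adj x y /\ S = [set x; y]) (S \in edges G).
Proof.
apply: (iffP imsetP) => [[[x y]]|[x [y [xy ->]]]]; last by exists (x, y).
by rewrite inE /= => xy ->; exists x, y.
Qed.

Lemma mem_edges x y : ([set x; y] \in edges G) = adj x y.
Proof.
apply/edgesP/idP => [[a [b [ab /eqP]]]|xy]; last by exists x, y.
by rewrite eq_set2 => /orP[]/andP[/eqP-> /eqP->] //; rewrite adj_sym.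
Qed.

Lemma card_edge S : S \in edges G -> #|S| = 2.
Proof.
case/edgesP=> x [y [xy ->]]; rewrite cards2; case: eqP xy => // ->.
by rewrite adj_irr.
Qed.

Lemma set0_edges : set0 \notin edges G.
Proof. by apply/negP => /card_edge; rewrite cards0. Qed.

Lemma edges_at x S : S \in edges G -> x \in S ->
  exists2 y, adj x y & S = [set x; y].
Proof.
case/edgesP=> a [b [ab ->]]; rewrite !inE => /orP[]/eqP->; first by exists b.
by exists a; rewrite 1?adj_sym // setUC.
Qed.

Lemma degree_edges x : degree (edges G) x = #|[set y | adj x y]|.
Proof.
rewrite -(card_in_imset (f := fun y => [set x; y])); last first.
  move=> y z _ _ /= /eqP; rewrite eq_set2 eqxx /= => /orP[/eqP//|].
  by case/andP=> /eqP-> /eqP->.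
apply: eq_card => S; rewrite inE; apply/andP/imsetP.
  by case=> SE xS; have [y xy ->] := edges_at SE xS; exists y; rewrite ?inE.
by case=> y; rewrite inE => xy ->; rewrite mem_edges xy !inE eqxx.
Qed.

End Edges.

Section CubicFlow.
Variables (T : finType) (E : {set {set T}}) (d : T -> color) (x : T).
Hypothesis deg3 : degree E x = 3.

Lemma sum_star (c : {ffun {set T} -> color}) :
  (forall S, (c S != 0%R) = (S \in E)) ->
  (\sum_(S : {set T} | x \in S) c S = \sum_(S in star E x) c S)%R.
Proof.
move=> cE; rewrite (bigID (mem E)) /= [X in (_ + X)%R]big1 ?addr0 => [|S].
  by apply: eq_bigl => S; rewrite inE andbC.
by case/andP=> _; rewrite -cE negbK => /eqP.
Qed.

(** If two of the three edges at [x] had the same colour, these would cancel in the sum, and the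
    third edge would have to carry 0. *)
Lemma inj_star (c : {ffun {set T} -> color}) :
  c \in flows E d -> d x = 0%R -> {in star E x &, injective c}.
Proof.
case/flowsP => cE cd dx S S' SD S'D eqc; apply/eqP/negPn/negP => SS'.
have := cd x; rewrite dx sum_star // (bigD1 S) //= (bigD1 S') /=; last first.
  by rewrite S'D eq_sym.
rewrite eqc addrA addcc add0r => /eqP.
have /eqP/cards1P[S'' eqS''] : #|star E x :\ S :\ S'| = 1.
  move: deg3; rewrite /degree (cardsD1 S) SD (cardsD1 S') !inE eq_sym SS'.
  by move: S'D; rewrite inE => ->; case.
rewrite (big_pred1 S'') => [|U]; last first.
  rewrite /= -[U == S'']in_set1 -eqS'' !in_setD1.
  by case: (U == S); case: (U == S'); case: (U \in _).
rewrite -[_ == _]negbK cE.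
have : S'' \in star E x :\ S :\ S' by rewrite eqS'' set11.
by rewrite in_setD1 in_setD1 inE => /and4P[_ _ ->].
Qed.

Lemma star_colors (c : {ffun {set T} -> color}) :
  (forall S, (c S != 0%R) = (S \in E)) -> {in star E x &, injective c} ->
  c @: star E x = [set~ (0%R : color)].
Proof.
move=> cE injc; apply/eqP; rewrite eqEcard; apply/andP; split.
  by apply/subsetP => _ /imsetP[S SD ->]; rewrite !inE cE; move: SD;
    rewrite inE => /andP[].
by rewrite (card_in_imset injc) cardsC1 card_prod card_bool [#|_|]deg3.
Qed.

(** Converse of [inj_star]: three different nonzero colours are all the nonzero colours, and these
    add up to 0. *)
Lemma sum_star_inj (c : {ffun {set T} -> color}) :
  (forall S, (c S != 0%R) = (S \in E)) -> {in star E x &, injective c} ->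
  (\sum_(S : {set T} | x \in S) c S = 0)%R.
Proof.
move=> cE injc; rewrite sum_star //.
rewrite -(big_imset (fun t : color => t) injc) /= star_colors //.
rewrite (bigD1 (true, false)) ?inE //= (bigD1 (false, true)) ?inE //=.
by rewrite (bigD1 (true, true)) ?inE //= big1 // => -[[] []]; rewrite !inE.
Qed.

End CubicFlow.

(** * Decompositions and flows *)

Section CountDecompositions.
Variable G : graph.
Hypotheses (G_gt0 : 0 < #|G|) (cubicG : cubic G).
Local Notation d0 := (fun _ : G => 0%R : color).

Let deg3 x : degree (edges G) x = 3.
Proof. by rewrite degree_edges cubicG. Qed.

Lemma flow_adjacent c S S' : c \in flows (edges G) d0 ->
  S \in edges G -> S' \in edges G -> adjacent_edges S S' -> c S != c S'.
Proof.
move=> cf SE S'E /andP[SS'] /pred0Pn[x /andP[/= xS xS']].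
apply: contra_neq SS'; apply: (inj_star (deg3 x) cf) => //.
  by rewrite inE SE.
by rewrite inE S'E.
Qed.

Definition color_class (c : {ffun {set G} -> color}) t : {set {set G}} :=
  [set S | c S == t].

Definition classes c : 3.-tuple {set {set G}} :=
  [tuple color_class c (true, false); color_class c (false, true);
         color_class c (true, true)].

Definition blocks (t : 3.-tuple {set {set G}}) : {set {set {set G}}} :=
  [set B in t].

(** Decompositions with their classes put in order. They mediate between [ED] and flows: the
    position of a class in the triple is its colour. *)
Definition labelled_ED : {set 3.-tuple {set {set G}}} :=
  [set t : 3.-tuple {set {set G}} | uniq t && (blocks t \in ED G)].

Lemma card_labelled_ED : #|labelled_ED| = 6 * #|ED G|.
Proof.
rewrite -sum1_card (partition_big blocks (mem (ED G))) /=; last first.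
  by move=> t; rewrite inE => /andP[].
rewrite mulnC -sum_nat_const; apply: eq_bigr => P PED; rewrite sum1dep_card.
have cP : #|P| = 3 by move: PED; rewrite inE => /and3P[_ /eqP].
(* The fibre over [P] consists of the duplicate-free triples with entries in the three-element set
   [P], of which there are 3! = 6. *)
transitivity (#|P| ^_ 3); last by rewrite cP.
rewrite -card_uniq_tuples.
apply: eq_card => t; rewrite !inE -andbA; have [ut|] := boolP (uniq t);
  last by rewrite andbF.
have ct : #|blocks t| = 3.
  by rewrite cardsE (card_uniqP ut) size_tuple.
rewrite andbT /=; apply/andP/allP => [[_ /eqP <-] B tB|tP].
  by have : B \in blocks t by rewrite inE.
have -> : blocks t = P.
  by apply/eqP; rewrite eqEcard ct cP leqnn andbT; apply/subsetP => B;
    rewrite inE => /tP.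
by rewrite eqxx; split=> //; move: PED; rewrite inE.
Qed.

Lemma classes_inj : injective classes.
Proof.
move=> c1 c2 /(congr1 val)[/setP e1 /setP e2 /setP e3]; apply/ffunP => S.
by move: (e1 S) (e2 S) (e3 S); rewrite !inE; case: (c1 S) (c2 S) => [[] []] [[] []].
Qed.

Lemma classes_labelled c : c \in flows (edges G) d0 -> classes c \in labelled_ED.
Proof.
move=> cf; have [cE cd] := flowsP _ _ _ cf.
(* All three colours occur at any one vertex, so no colour class is empty. *)
have [x0 _] := card_gt0P G_gt0.
have class_neq0 t : t != 0%R -> color_class c t != set0.
  move=> nz_t; have : t \in c @: star (edges G) x0.
    by rewrite (star_colors (deg3 x0) cE (inj_star (deg3 x0) cf _)) // !inE.
  by case/imsetP=> S _ tS; apply/set0Pn; exists S; rewrite inE tS.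
have class_disj t t' : t != t' -> [disjoint color_class c t & color_class c t'].
  move=> tt'; apply/pred0P => S; rewrite /= !inE; case: eqP => // ->.
  exact: negPf.
have class_neq t t' : t != 0%R -> t != t' -> color_class c t != color_class c t'.
  move=> nz_t tt'; apply: contraTneq (class_disj _ _ tt') => <-.
  by rewrite -setI_eq0 setIid class_neq0.
have mem_blocks B : B \in blocks (classes c) ->
    exists2 t, t != 0%R & B = color_class c t.
  by rewrite !inE => /or3P[]/eqP->;
    [exists (true, false)|exists (false, true)|exists (true, true)].
have ut : uniq (classes c) by rewrite /= !inE !negb_or !class_neq.
rewrite inE ut /= [_ \in ED G]inE; apply/and3P; split.
- apply/and3P; split.
  + apply/eqP/setP => S; rewrite -cE; apply/bigcupP/idP.
      by case=> B /mem_blocks[t nz_t ->]; rewrite inE => /eqP->.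
    move=> nz_cS; exists (color_class c (c S)); last by rewrite inE.
    by rewrite !inE; case: (c S) nz_cS => [[] []] //; rewrite eqxx ?orbT.
  + apply/trivIsetP => B B' /mem_blocks[t nz_t ->] /mem_blocks[t' nz_t' ->] BB'.
    by apply: class_disj; apply: contra_neq BB' => ->.
  + by apply/negP => /mem_blocks[t /class_neq0 /eqP nB /esym].
- by rewrite cardsE (card_uniqP ut).
- apply/forall_inP => B /mem_blocks[t nz_t ->].
  apply/forall_inP => S; rewrite inE => /eqP cS.
  apply/forall_inP => S'; rewrite inE => /eqP cS'.
  apply/negP => /(flow_adjacent cf) /negP; apply; rewrite -?cE ?cS ?cS' //.
Qed.

Lemma labelled_classes t : t \in labelled_ED ->
  exists2 c, c \in flows (edges G) d0 & t = classes c.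
Proof.
case/tupleP: t => B1 t; case/tupleP: t => B2 t; case/tupleP: t => B3 t.
rewrite tuple0 inE => /andP[ut];
  rewrite inE => /and3P[/and3P[/eqP covE /trivIsetP disP _] _ adjP].
(* The blocks are disjoint, so the order of the tests is immaterial; sets that are not edges lie in
   no block and get 0. *)
pose c : {ffun {set G} -> color} := [ffun S => if S \in B1 then (true, false)
  else if S \in B2 then (false, true) else if S \in B3 then (true, true) else 0%R].
have [b1 [b2 b3]] : B1 \in blocks [tuple B1; B2; B3] /\
    B2 \in blocks [tuple B1; B2; B3] /\ B3 \in blocks [tuple B1; B2; B3].
  by rewrite !inE !eqxx !orbT.
move: ut; rewrite /= !inE !negb_or => /and3P[/andP[B12 B13] B23 _].
have disj B B' : B \in blocks [tuple B1; B2; B3] -> B' \in blocks [tuple B1; B2;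
  B3] ->
    B != B' -> forall S, S \in B -> S \in B' = false.
  by move=> bB bB' BB' S SB; apply: (disjointFr (disP _ _ bB bB' BB')).
have memE S : (S \in edges G) = [|| S \in B1, S \in B2 | S \in B3].
  rewrite -covE; apply/bigcupP/or3P.
    by case=> B; rewrite !inE => /or3P[]/eqP-> ?;
      [constructor 1|constructor 2|constructor 3].
  by case=> SB; [exists B1|exists B2|exists B3].
have cE S : (c S != 0%R) = (S \in edges G).
  by rewrite memE ffunE; do 3 case: ifP => //.
exists c; last first.
  apply/val_inj; congr [:: _; _; _]; apply/setP => S; rewrite inE ffunE.
  - by case: ifP => // _; do 2 case: ifP => //.
  - have [/(disj _ _ b1 b2 B12)->//|_] := boolP (S \in B1).
    by case: ifP => // _; case: ifP.
  - have [/(disj _ _ b1 b3 B13)->//|_] := boolP (S \in B1).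
    have [/(disj _ _ b2 b3 B23)->//|_] := boolP (S \in B2).
    by case: ifP.
apply/flowsP; split=> // x; apply: (sum_star_inj (deg3 x) cE) => S S'.
rewrite !inE => /andP[SE xS] /andP[S'E xS'] eqc; apply/eqP/negPn/negP => SS'.
have SadjS' : adjacent_edges S S'.
  by rewrite /adjacent_edges SS' /=; apply/pred0Pn; exists x; rewrite /= xS.
have noB B : B \in blocks [tuple B1; B2; B3] -> S \in B -> S' \in B -> False.
  move=> bB SB S'B; move/forall_inP/(_ B bB)/forall_inP/(_ S SB): adjP.
  by move/forall_inP/(_ S' S'B); rewrite SadjS'.
move: eqc SE; rewrite memE !ffunE.
have := noB _ b1; have := noB _ b2; have := noB _ b3.
case: (S \in B1); case: (S' \in B1); case: (S \in B2); case: (S' \in B2);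
  case: (S \in B3); case: (S' \in B3) => //= n3 n2 n1 _ _;
    by [apply: n1|apply: n2|apply: n3].
Qed.

Lemma card_ED : 6 * #|ED G| = nflows (edges G) d0.
Proof.
rewrite -card_labelled_ED /nflows -(card_imset _ classes_inj).
apply: eq_card => t; apply/idP/imsetP => [/labelled_classes//|[c cf ->]].
exact: classes_labelled.
Qed.

End CountDecompositions.

(** The colour 0 shares the index 2 with [(true, true)]; injectivity is claimed on nonzero colours
    only, and edges carry no others. *)
Definition color_index (t : color) : 'I_3 :=
  if t == (true, false) then inord 0 else
  if t == (false, true) then inord 1 else inord 2.

Lemma color_index_inj : {in [pred t : color | t != 0%R] &, injective color_index}.
Proof.
by move=> [[] []] [[] []] //= _ _ /(congr1 val); rewrite /color_index /= !inordK.
Qed.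

Lemma nflows_uncolorable (G : graph) : cubic G ->
  ~ (exists f : edge G -> 'I_3, edge_3_coloring f) ->
  nflows (edges G) (fun _ => 0%R) = 0.
Proof.
move=> cubicG nocol; apply/eqP; rewrite cards_eq0 -subset0; apply/subsetP => c cf.
case: nocol; exists (fun S => color_index (c (val S))) => S S' SS'.
have [cE _] := flowsP _ _ _ cf.
move/color_index_inj; rewrite !inE !cE (valP S) (valP S') => /(_ isT isT)/eqP.
exact/negP/(flow_adjacent cubicG cf (valP S) (valP S') SS').
Qed.

(** * Kempe chains *)

(** Membership in the subgroup generated by [q]. For nonzero [q], adding [q] exchanges the two
    colours outside it. *)
Definition in0q (q t : color) : bool := (t == 0%R) || (t == q).

Lemma in0qD q t t' : in0q q t -> in0q q t' -> in0q q (t + t')%R.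
Proof. by move: q t t' => [[] []] [[] []] [[] []]. Qed.

Lemma in0q_sum (I : Type) (r : seq I) (P : pred I) (F : I -> color) q :
  (forall i, P i -> in0q q (F i)) -> in0q q (\sum_(i <- r | P i) F i)%R.
Proof. by move=> qF; apply: (big_ind (fun t => in0q q t)) => // t t';
  apply: in0qD. Qed.

Section Kempe.
Variables (T : finType) (E : {set {set T}}) (q : color).
Hypothesis E2 : forall S, S \in E -> #|S| = 2.

Implicit Types (M : {set {set T}}) (c h : {ffun {set T} -> color}) (d : T -> color).

(** In a flow, these are the edges of the two colours that a Kempe switch with [q] exchanges. *)
Definition offcolor c : {set {set T}} :=
  [set S in E | c S != q].

(** A Kempe chain is encoded as a chain modulo 2 rather than as a path: it takes the value [q] on
    some edges of [M], and its boundary sits at [x] and [y]. For [x = y] the two boundary terms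
    cancel. *)
Definition chain M (x y : T) h :=
  [forall S, (h S == 0%R) || (h S == q) && (S \in M)] &&
  [forall v, (\sum_(S : {set T} | v \in S) h S)%R ==
     (q *+ (v == x) + q *+ (v == y))%R].

Lemma chainP M x y h :
  reflect ((forall S, h S = 0%R \/ h S = q /\ S \in M) /\
    forall v, (\sum_(S : {set T} | v \in S) h S)%R =
      (q *+ (v == x) + q *+ (v == y))%R)
    (chain M x y h).
Proof.
apply: (iffP andP) => -[hM hv]; split.
- by move=> S; move/forallP/(_ S): hM => /orP[/eqP|/andP[/eqP]]; [left|right].
- by move=> v; apply/eqP/(forallP hv).
- by apply/forallP => S; case: (hM S) => [->|[-> ->]]; rewrite eqxx ?orbT.
- by apply/forallP => v; apply/eqP.
Qed.

Lemma chain_refl M x : chain M x x [ffun=> 0%R].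
Proof.
apply/chainP; split=> [S|v]; first by left; rewrite ffunE.
by rewrite addcc big1 // => S _; rewrite ffunE.
Qed.

(** The new edge is added modulo 2: if it already occurs in [h] it cancels, so repeated edges need
    no special treatment. *)
Lemma chain_step M x a b h : a != b -> [set a; b] \in M -> chain M x a h ->
  exists h', chain M x b h'.
Proof.
move=> ab abM /chainP[hM hv].
exists [ffun S => (h S + q *+ (S == [set a; b]))%R]; apply/chainP; split=> [S|v].
  rewrite ffunE; case: eqVneq => [->|_]; last by rewrite addr0; apply: hM.
  by case: (hM [set a; b]) => [->|[-> _]]; [right; rewrite add0r|left;
    rewrite addcc].
under eq_bigr do rewrite ffunE.
rewrite big_split /= hv.
have -> : (\sum_(S : {set T} | v \in S) q *+ (S == [set a; b]) =
    q *+ (v \in [set a; b]))%R.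
  have [vab|vab] := boolP (v \in [set a; b]); last first.
    by apply: big1 => S vS; case: eqP vab => // <-; rewrite vS.
  rewrite (bigD1 [set a; b]) //= eqxx big1 ?addr0 ?vab // => S /andP[_ /negPf->];
    rewrite mulr0n //.
rewrite in_set2; have [->|_] := eqVneq v a.
  by rewrite (negPf ab) mulr0n addr0 -addrA addcc addr0.
by rewrite mulr0n addr0.
Qed.

(* [R], the set of ends of chains from [x], is closed under the edges not coloured
   [q]; hence the demands over [R] add up to 0 or [q], and [x] is not the only
   vertex of [R] whose demand is neither. *)
Lemma kempe_chain d c x : c \in flows E d -> ~~ in0q q (d x) ->
  exists y h, [/\ y != x, ~~ in0q q (d y) & chain (offcolor c) x y h].
Proof.
move=> cf ndx; have [cE _] := flowsP _ _ _ cf.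
pose R := [set y | [exists h, chain (offcolor c) x y h]].
have xR : x \in R by rewrite inE; apply/existsP; exists [ffun=> 0%R];
  apply: chain_refl.
have RM S : S \in offcolor c -> #|S :&: R| = 0 \/ #|S :&: R| = 2.
  move=> SM; have : S \in E by move: SM; rewrite inE => /andP[].
  move=> SE; have /eqP/cards2P[a [b [ab eqS]]] := E2 SE; rewrite eqS in SM.
  have Rab : (a \in R) = (b \in R).
    rewrite !inE; apply/existsP/existsP => -[h]; first exact: chain_step.
    by apply: chain_step; rewrite 1?eq_sym 1?setUC.
  have [aR|aR] := boolP (a \in R); [right|left].
    rewrite (setIidPl _) eqS ?cards2 ?ab //.
    by apply/subsetP => v; rewrite in_set2 => /orP[]/eqP->; rewrite -?Rab.
  apply/eqP; rewrite cards_eq0 setI_eq0 eqS; apply/pred0P => v /=.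
  by rewrite in_set2; case/boolP: (_ || _) => //= /orP[]/eqP->;
    rewrite -?Rab (negPf aR).
have sumR : in0q q (\sum_(y in R) d y)%R.
  rewrite (sum_demand _ cf); apply: in0q_sum => S SE.
  have [cSq|cSq] := eqVneq (c S) q; last first.
    case: (RM S) => [|->|->]; rewrite ?inE ?SE // ?mulr0n /in0q ?eqxx //.
    by rewrite mulr2n addcc.
  rewrite cSq; elim: #|_| => [|n IHn]; first by rewrite /in0q eqxx.
  by rewrite mulrS; apply: in0qD; rewrite // /in0q eqxx orbT.
have [|none] := boolP [exists y in R, (y != x) && ~~ in0q q (d y)].
  case/exists_inP => y; rewrite inE => /existsP[h hy] /andP[yx dy].
  by exists y, h.
case/negP: ndx; rewrite (_ : d x =
  \sum_(y in R) d y - \sum_(y in R | y != x) d y)%R.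
  rewrite oppc; apply: in0qD => //; apply: in0q_sum => y /andP[yR yx].
  by move: none; rewrite negb_exists => /forallP/(_ y); rewrite yR yx /= negbK.
by rewrite (bigD1 x) //= addrK.
Qed.

Definition swap c h : {ffun {set T} -> color} := [ffun S => (c S + h S)%R].

(** On the chain the colours are neither 0 nor [q], so adding [q] keeps them nonzero; the demands
    change by the boundary of the chain. *)
Lemma swap_flow d c x y h : q != 0%R -> c \in flows E d ->
  chain (offcolor c) x y h ->
  swap c h \in flows E (fun v => d v + (q *+ (v == x) + q *+ (v == y)))%R.
Proof.
move=> nzq /flowsP[cE cd] /chainP[hM hv]; apply/flowsP; split=> [S|v].
  rewrite ffunE -cE; case: (hM S) => [->|[-> ]]; first by rewrite addr0.
  rewrite inE => /andP[SE]; have := cE S; rewrite SE.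
  by move: nzq; case: q (c S) => [[] []] [[] []].
under eq_bigr do rewrite ffunE.
by rewrite big_split /= cd hv.
Qed.

Lemma offcolor_swap c x y h :
  (forall S, (c S != 0%R) = (S \in E)) ->
  chain (offcolor c) x y h -> offcolor (swap c h) = offcolor c.
Proof.
move=> cE /chainP[hM _]; apply/setP => S; rewrite !inE ffunE.
case: (hM S) => [->|[->]]; first by rewrite addr0.
rewrite inE => /andP[SE ->]; move: (cE S); rewrite SE andbT /=.
by case: q (c S) => [[] []] [[] []].
Qed.

(* The chain is chosen as a function of [offcolor c], which the swap does not
   change; this makes the swap injective. *)
Lemma leq_nflows_swap d x y : q != 0%R ->
  (forall c, c \in flows E d -> exists h, chain (offcolor c) x y h) ->
  nflows E d <= nflows E (fun v => d v + (q *+ (v == x) + q *+ (v == y)))%R.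
Proof.
move=> nzq exh.
pose pick_chain M := odflt [ffun=> 0%R] [pick h | chain M x y h].
have pickP c : c \in flows E d -> chain (offcolor c) x y (pick_chain (offcolor c)).
  move=> /exh[h0 ch0]; rewrite /pick_chain; case: pickP => [//|no].
  by have := no h0; rewrite ch0.
pose phi c := swap c (pick_chain (offcolor c)).
have phi_inj : {in flows E d &, injective phi}.
  move=> c1 c2 f1 f2 eqphi.
  have [c1E _] := flowsP _ _ _ f1; have [c2E _] := flowsP _ _ _ f2.
  have eqM : offcolor c1 = offcolor c2.
    rewrite -(offcolor_swap c1E (pickP _ f1)) -(offcolor_swap c2E (pickP _ f2)).
    by rewrite -/(phi c1) eqphi.
  apply/ffunP => S; have := congr1 (fun f : {ffun _} => f S) eqphi.
  by rewrite !ffunE eqM; apply: addIr.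
rewrite /nflows -(card_in_imset phi_inj); apply/subset_leq_card/subsetP => c.
by case/imsetP=> c' f' ->; apply: swap_flow => //; apply: pickP.
Qed.

End Kempe.

(** * Switching in four-poles *)

Section Pole.
Variables (T : finType) (E : {set {set T}}).
Hypothesis E2 : forall S, S \in E -> #|S| = 2.

Definition demand4 (x y z w : T) (t1 t2 w1 w2 : color) : T -> color :=
  fun v => (t1 *+ (v == x) + t2 *+ (v == y) + w1 *+ (v == z) + w2 *+ (v == w))%R.

Section SwitchedDemand.
Variables (x y z w : T) (t1 t2 w1 w2 q : color) (v : T).
Local Notation d := (demand4 x y z w t1 t2 w1 w2 v).

Lemma demand4_xy : (d + (q *+ (v == x) + q *+ (v == y)) =
  demand4 x y z w (t1 + q) (t2 + q) w1 w2 v)%R.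
Proof. by rewrite /demand4 !mulrnDl [LHS](AC (4*2) ((1*5)*(2*6)*3*4))%AC. Qed.

Lemma demand4_xz : (d + (q *+ (v == x) + q *+ (v == z)) =
  demand4 x y z w (t1 + q) t2 (w1 + q) w2 v)%R.
Proof. by rewrite /demand4 !mulrnDl [LHS](AC (4*2) ((1*5)*2*(3*6)*4))%AC. Qed.

Lemma demand4_xw : (d + (q *+ (v == x) + q *+ (v == w)) =
  demand4 x y z w (t1 + q) t2 w1 (w2 + q) v)%R.
Proof. by rewrite /demand4 !mulrnDl [LHS](AC (4*2) ((1*5)*2*3*(4*6)))%AC. Qed.

End SwitchedDemand.

Variables x y z w : T.
Hypotheses (xy : x != y) (xz : x != z) (xw : x != w).
Hypotheses (yz : y != z) (yw : y != w) (zw : z != w).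

(** Dangling edges are not members of [E]; each is represented by the demand that its colour makes
    at its end. *)
Definition pole t1 t2 w1 w2 := nflows E (demand4 x y z w t1 t2 w1 w2).

Hypothesis pole_eq : forall t1 t2 w1 w2,
  t1 != 0%R -> t2 != 0%R -> w1 != 0%R -> w2 != 0%R ->
  pole t1 t2 w1 w2 != 0 -> t1 = t2 /\ w1 = w2.

(** Every Kempe chain from [x] must end at [y]: a chain ending at [z] or [w] could be switched to a
    flow with different colours at [x] and [y], against [pole_eq]. Switching the chains from [x] to
    [y] turns [t] into [t'] at both ports. *)
Lemma leq_pole t t' s : t != 0%R -> t' != 0%R -> s != 0%R ->
  pole t t s s <= pole t' t' s s.
Proof.
move=> nzt nzt' nzs; have [->//|tt'] := eqVneq t t'.
(* The switch uses [q = t + t'], since adding this colour exchanges [t] and [t']. *)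
have nzq : (t + t')%R != 0%R by rewrite addc_eq0.
have t'E : t' = (t + (t + t'))%R by rewrite addrA addcc add0r.
move: nzq t'E; move: (t + t')%R => q nzq t'E.
have t_neq : t = (t + q)%R -> False.
  by rewrite -{1}[t]addr0 => /addrI/esym/eqP; rewrite (negPf nzq).
rewrite /pole [X in _ <= X](_ : _ = nflows E (fun v =>
  demand4 x y z w t t s s v + (q *+ (v == x) + q *+ (v == y)))%R); last first.
  by apply: eq_nflows => v; rewrite demand4_xy -t'E.
apply: leq_nflows_swap => // c cf.
have ndx : ~~ in0q q (demand4 x y z w t t s s x).
  rewrite /demand4 eqxx (negPf xy) (negPf xz) (negPf xw) !addr0 mulr1n.
  by rewrite /in0q negb_or nzt -addc_eq0 -t'E.
have [v [h [vx ndv hv]]] := kempe_chain E2 cf ndx.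
have sw := swap_flow nzq cf hv.
(* A chain ending at [u] that leaves the demand [t] at [y] alone while [x] gets [t + q] contradicts
   [pole_eq]. *)
have unbalanced u w1 w2 :
    (forall v', demand4 x y z w t t s s v' + (q *+ (v' == x) + q *+ (v' == u)) =
      demand4 x y z w (t + q) t w1 w2 v')%R ->
    v = u -> w1 != 0%R -> w2 != 0%R -> False.
  move=> eqd vu nz1 nz2; have [] := pole_eq (t1 := (t + q)%R) _ nzt nz1 nz2 _;
    rewrite -?t'E //.
    rewrite /pole t'E -(eq_nflows _ eqd) cards_eq0; apply/set0Pn.
    by exists (swap c h); rewrite -vu.
  by rewrite t'E => /esym.
have [vy|vy] := eqVneq v y; first by exists h; rewrite -vy.
(* At [z] or [w] the demand [s] is neither 0 nor [q], so [s + q] is nonzero, as [pole_eq] requires.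
   At a vertex that is no port the demand is 0, and no chain from [kempe_chain] ends there. *)
exfalso; move: ndv; rewrite /demand4 (negPf vx) (negPf vy) !add0r.
have [vz|vz] := eqVneq v z.
  rewrite vz (negPf zw) addr0 mulr1n /in0q negb_or -(addc_eq0 s q) => /andP[_ nzsq].
  exact: (unbalanced z (s + q)%R s (demand4_xz _ _ _ _ _ _ _ _ _) vz nzsq nzs).
have [vw|vw] := eqVneq v w; last by rewrite addr0 /in0q eqxx.
rewrite add0r mulr1n /in0q negb_or -(addc_eq0 s q) => /andP[_ nzsq].
exact: (unbalanced w s (s + q)%R (demand4_xw _ _ _ _ _ _ _ _ _) vw nzs nzsq).
Qed.

Lemma pole_const_l t t' s : t != 0%R -> t' != 0%R -> s != 0%R ->
  pole t t s s = pole t' t' s s.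
Proof. by move=> nzt nzt' nzs; apply/eqP; rewrite eqn_leq !leq_pole. Qed.

End Pole.

(** * Suppressing the ends of a removed edge *)

(** The two edges at [z] have colours [s] and [t] with [s + t = 0], hence [s = t], and [a] and [b]
    cannot tell them from a single edge of that colour. *)
Lemma nflows_suppress (T : finType) (E : {set {set T}}) (z a b : T) d :
  (forall S, S \in E -> z \notin S) -> z != a -> z != b -> a != b ->
  [set a; b] \notin E -> d z = 0%R ->
  nflows ([set z; a] |: ([set z; b] |: E)) d = nflows ([set a; b] |: E) d.
Proof.
move=> Ez za zb ab abE dz.
have zE c : [set z; c] \notin E by apply/negP => /Ez; rewrite set21.
rewrite !nflowsU1 ?zE //; last first.
  by rewrite !inE eq_set2 eqxx (negPf ab) (negPf zb) (negPf (zE a)).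
transitivity (nzsum (fun s => nzsum (fun t =>
  nflows E (shift (shift d [set z; a] s) [set z; b] t)))).
  by apply: eq_nzsum => s _; rewrite nflowsU1 ?zE.
rewrite nzsum_diag => [|s t st].
  apply: eq_nzsum => s _; apply: eq_nflows => v; rewrite /shift !inE.
  have [->|_] /= := eqVneq v z; first by rewrite (negPf za) (negPf zb) dz !addr0
    mulr1n add0r addcc.
  have [->|_] /= := eqVneq v a; first by rewrite (negPf ab) addr0.
  by rewrite addr0.
apply: (nflows_isolated Ez); rewrite /shift dz !set21 add0r !mulr1n.
by rewrite addc_eq0.
Qed.

Lemma imset_set2 (X Y : finType) (f : X -> Y) a b :
  f @: [set a; b] = [set f a; f b].
Proof. by rewrite imsetU !imset_set1. Qed.

Lemma imset_edgesP (G : graph) (X : finType) (j : G -> X) S :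
  reflect (exists a b, adj a b /\ S = [set j a; j b])
    (S \in [set j @: S' | S' : {set G} in edges G]).
Proof.
apply: (iffP imsetP) => [[S' /edgesP[a [b [ab ->]]] ->]|[a [b [ab ->]]]].
  by exists a, b; rewrite imset_set2.
by exists [set a; b]; rewrite ?mem_edges ?imset_set2.
Qed.

Lemma disjoint_set2 (T : finType) (a b : T) (Q : {set T}) :
  [disjoint [set a; b] & Q] = (a \notin Q) && (b \notin Q).
Proof. by rewrite disjoints_subset subUset !sub1set !inE. Qed.

(** The edges of [G - Q], kept as sets of vertices of [G] so that they can be compared with the
    edges of [G]. *)
Definition edges_off (G : graph) (Q : {set G}) : {set {set G}} :=
  [set S in edges G | [disjoint S & Q]].

Lemma edges_off_notin (G : graph) (Q : {set G}) x S :
  x \in Q -> S \in edges_off Q -> x \notin S.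
Proof. by move=> xQ; rewrite inE => /andP[_ dis]; rewrite (disjointFl dis). Qed.

Lemma edges_del_vertices (G : graph) (Q : {set G}) :
  [set val @: S | S : {set del_vertices Q} in edges (del_vertices Q)] =
  edges_off Q.
Proof.
apply/setP => S; apply/imset_edgesP/idP => [[a [b [ab ->]]]|].
  by rewrite inE mem_edges disjoint_set2 (valP a) (valP b) !andbT.
rewrite inE => /andP[/edgesP[a [b [ab ->]]]]; rewrite disjoint_set2 => /andP[aQ bQ].
by exists (Sub a aQ), (Sub b bQ).
Qed.

Section Reduction.
Variables (G : graph) (x y t1 t2 w1 w2 : G).
Hypotheses (t12 : t1 != t2) (t1y : t1 != y) (t2y : t2 != y).
Hypotheses (w12 : w1 != w2) (w1x : w1 != x) (w2x : w2 != x).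
Hypothesis adjx : forall z, adj x z = [|| z == y, z == t1 | z == t2].
Hypothesis adjy : forall z, adj y z = [|| z == x, z == w1 | z == w2].
Local Notation e := [set x; y].

Lemma edges_around : edges G =
  e |: ([set x; t1] |: ([set x; t2] |: ([set y; w1] |: ([set y;
    w2] |: edges_off e)))).
Proof.
apply/setP => S; rewrite !in_setU1; apply/idP/idP.
  move=> SE; have [xS|xS] := boolP (x \in S).
    by have [z] := edges_at SE xS; rewrite adjx => /or3P[]/eqP-> ->;
      rewrite eqxx ?orbT.
  have [yS|yS] := boolP (y \in S).
    have [z] := edges_at SE yS; rewrite adjy => /or3P[]/eqP-> ->;
      rewrite ?eqxx ?orbT //.
    by rewrite setUC eqxx.
  by rewrite inE SE disjoint_sym disjoint_set2 xS yS !orbT.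
do 5 (case/orP=> [/eqP->|]; first by rewrite mem_edges ?adjx ?adjy eqxx ?orbT).
by rewrite inE => /andP[].
Qed.
Hypotheses (triangle_x : forall a b, adj x a -> adj x b -> ~~ adj a b).
Hypotheses (triangle_y : forall a b, adj y a -> adj y b -> ~~ adj a b).

Let adj_neq (p q : G) : adj p q -> p != q.
Proof. by apply: contraTneq => <-; rewrite adj_irr. Qed.

Let xy : x != y. Proof. by rewrite adj_neq // adjx eqxx. Qed.
Let xt1 : x != t1. Proof. by rewrite adj_neq // adjx eqxx orbT. Qed.
Let xt2 : x != t2. Proof. by rewrite adj_neq // adjx eqxx !orbT. Qed.
Let yw1 : y != w1. Proof. by rewrite adj_neq // adjy eqxx orbT. Qed.
Let yw2 : y != w2. Proof. by rewrite adj_neq // adjy eqxx !orbT. Qed.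

Let adj_t z : z \in [set t1; t2] -> adj x z.
Proof. by rewrite !inE adjx => ->; rewrite orbT. Qed.
Let adj_w z : z \in [set w1; w2] -> adj y z.
Proof. by rewrite !inE adjy => ->; rewrite orbT. Qed.

(** A common neighbour of [x] and [y] would close a triangle with the edge between them. *)
Let tw z z' : z \in [set t1; t2] -> z' \in [set w1; w2] -> z != z'.
Proof.
move=> /adj_t xz /adj_w yz'; apply: contraTneq yz' => <-.
by apply: triangle_x; rewrite // adjx eqxx.
Qed.

Lemma edges_edge_reduction :
  [set val @: S | S : {set edge_reduction e} in edges (edge_reduction e)] =
  [set w1; w2] |: ([set t1; t2] |: edges_off e).
Proof.
apply/setP => S; rewrite !in_setU1; apply/imset_edgesP/idP => [[a [b []]]|].
  rewrite /= /edge_reduction_adj => /orP[ab ->|].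
    by rewrite inE mem_edges disjoint_set2 (valP a) (valP b) !andbT [adj _ _]ab
      !orbT.
  case/andP=> ab /exists_inP[z ze /andP[za zb]] ->.
  have [ax ay] : val a != x /\ val a != y.
    by have := valP a; rewrite !inE negb_or => /andP.
  have [bx by_] : val b != x /\ val b != y.
    by have := valP b; rewrite !inE negb_or => /andP.
  have vab : val a != val b by [].
  move: ze; rewrite !inE => /orP[]/eqP eqz; move: za zb vab;
    rewrite eqz ?adjx ?adjy.
    rewrite (negPf ay) (negPf by_) /= => /orP[]/eqP-> /orP[]/eqP->;
      rewrite ?eqxx //.
      by rewrite orbT.
    by rewrite setUC eqxx orbT.
  rewrite (negPf ax) (negPf bx) /= => /orP[]/eqP-> /orP[]/eqP->; rewrite ?eqxx //.
  by rewrite setUC eqxx.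
have w1e : w1 \notin e by rewrite !inE negb_or w1x eq_sym.
have w2e : w2 \notin e by rewrite !inE negb_or w2x eq_sym.
have t1e : t1 \notin e by rewrite !inE negb_or t1y eq_sym xt1.
have t2e : t2 \notin e by rewrite !inE negb_or t2y eq_sym xt2.
case/or3P=> [/eqP->|/eqP->|].
- exists (Sub w1 w1e), (Sub w2 w2e); split=> //; apply/orP; right.
  rewrite -val_eqE /= w12; apply/exists_inP; exists y; rewrite ?set22 //.
  by rewrite !adjy !eqxx !orbT.
- exists (Sub t1 t1e), (Sub t2 t2e); split=> //; apply/orP; right.
  rewrite -val_eqE /= t12; apply/exists_inP; exists x; rewrite ?set21 //.
  by rewrite !adjx !eqxx !orbT.
rewrite inE => /andP[/edgesP[a [b [ab ->]]]]; rewrite disjoint_set2 => /andP[ae be].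
by exists (Sub a ae), (Sub b be); split=> //; apply/orP; left.
Qed.

Let offx z : [set x; z] \notin edges_off e.
Proof. by rewrite inE disjoint_set2 set21 andbF. Qed.
Let offy z : [set y; z] \notin edges_off e.
Proof. by rewrite inE disjoint_set2 set22 andbF. Qed.
(** The absence of triangles makes the joining edge new, so it can be split off by [nflowsU1]; the
    next fact does the same on the other side. *)
Let offt : [set t1; t2] \notin edges_off e.
Proof.
by rewrite inE mem_edges negb_and triangle_x // adj_t // !inE eqxx ?orbT.
Qed.
Let offw : [set w1; w2] \notin [set t1; t2] |: edges_off e.
Proof.
rewrite in_setU1 negb_or eq_set2 ![w1 == _]eq_sym ![w2 == _]eq_sym.
rewrite !(negPf (tw _ _)) ?inE ?eqxx ?orbT //= mem_edges negb_and.
by rewrite triangle_y // adj_w // !inE eqxx ?orbT.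
Qed.

Let eE : e \notin
  [set x; t1] |: ([set x; t2] |: ([set y; w1] |: ([set y; w2] |: edges_off e))).
Proof.
rewrite !in_setU1 !eq_set2 !eqxx (negPf (offx y)).
rewrite ![y == t1]eq_sym ![y == t2]eq_sym ![x == w1]eq_sym ![x == w2]eq_sym.
by rewrite (negPf xy) (negPf t1y) (negPf t2y) (negPf w1x) (negPf w2x) (negPf xt1)
  (negPf xt2).
Qed.
Let xt1E : [set x; t1] \notin
  [set x; t2] |: ([set y; w1] |: ([set y; w2] |: edges_off e)).
Proof.
rewrite !in_setU1 !eq_set2 !eqxx (negPf (offx t1)) ![x == w1]eq_sym ![x ==
  w2]eq_sym.
by rewrite (negPf xy) (negPf xt2) (negPf t12) (negPf w1x) (negPf w2x).
Qed.
Let xt2E : [set x; t2] \notin [set y; w1] |: ([set y; w2] |: edges_off e).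
Proof.
rewrite !in_setU1 !eq_set2 (negPf (offx t2)) ![x == w1]eq_sym ![x == w2]eq_sym.
by rewrite (negPf xy) (negPf w1x) (negPf w2x).
Qed.
Let yw1E : [set y; w1] \notin [set y; w2] |: edges_off e.
Proof.
by rewrite !in_setU1 !eq_set2 eqxx (negPf (offy w1)) (negPf w12) (negPf yw2).
Qed.

(** Without [e], the vertices [x] and [y] have degree two and are suppressed one after the other. *)
Lemma nflows_del_edge :
  nflows (edges G :\ e) (fun _ => 0%R) =
  nflows ([set w1; w2] |: ([set t1; t2] |: edges_off e)) (fun _ => 0%R).
Proof.
rewrite edges_around setU1K // nflows_suppress //; first last.
- rewrite !in_setU1 !eq_set2 ![t1 == y]eq_sym ![t2 == y]eq_sym.
  rewrite ![y == t1]eq_sym ![y == t2]eq_sym (negPf t1y) (negPf t2y) /=.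
  by rewrite !andbF /= (negPf offt).
- move=> S; rewrite !in_setU1 => /or3P[/eqP->|/eqP->|/edges_off_notin->//].
  + by rewrite !inE negb_or xy eq_sym.
  + by rewrite !inE negb_or xy eq_sym.
  + by rewrite set21.
(* The edge that replaced [x] is moved behind the two edges at [y], so that [y] can be
   suppressed. *)
rewrite (setUCA [set [set t1; t2]] [set [set y; w1]]) (setUCA [set [set t1;
  t2]] [set [set y; w2]]) nflows_suppress //.
move=> S; rewrite in_setU1 => /orP[/eqP->|/edges_off_notin->//];
  last by rewrite set22.
by rewrite !inE negb_or eq_sym t1y eq_sym.
Qed.

Lemma nflows_edge_reduction :
  nflows (edges (edge_reduction e)) (fun _ => 0%R) =
  nflows (edges G :\ e) (fun _ => 0%R).
Proof.
rewrite nflows_del_edge -edges_edge_reduction nflows_imset; last exact: val_inj.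
by rewrite (_ : [forall _, _] = true) ?muln1 //; apply/forallP => ?; apply/implyP.
Qed.

Lemma nflows_del_edge_sum :
  nflows (edges G :\ e) (fun _ => 0%R) =
  nzsum (fun w => nzsum (fun t => nflows (edges_off e)
    (shift (shift (fun _ => 0%R) [set w1; w2] w) [set t1; t2] t))).
Proof.
by rewrite nflows_del_edge nflowsU1 //; apply: eq_nzsum => w _; rewrite nflowsU1.
Qed.

(** Each of [t1], [t2], [w1], [w2] trades its edge to [x] or [y] for one joining edge; the other
    surviving vertices keep their edges. *)
Lemma cubic_edge_reduction : cubic G -> cubic (edge_reduction e).
Proof.
move=> cubicG a; rewrite -degree_edges -(degree_imset (j := val));
  last exact: val_inj.
have [ax ay] : val a != x /\ val a != y.
  by have := valP a; rewrite !inE negb_or => /andP.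
move: (cubicG (val a)); rewrite edges_edge_reduction -degree_edges edges_around.
rewrite !degreeU1 // !inE (negPf ax) (negPf ay) /= => <-.
have orb_addn p q : p != q ->
    ((val a == p) || (val a == q) : nat) = (val a == p) + (val a == q).
  by move=> pq; have [->|_] := eqVneq (val a) p; rewrite ?(negPf pq).
by rewrite !orb_addn // add0n addnCA !addnA.
Qed.

End Reduction.

Lemma mulrb_set2 (T : finType) (a b v : T) (t : color) : a != b ->
  (t *+ (v \in [set a; b]) = t *+ (v == a) + t *+ (v == b))%R.
Proof.
move=> ab; rewrite in_set2; have [->|_] := eqVneq v a; last by rewrite add0r.
by rewrite (negPf ab) addr0.
Qed.

Lemma cubic_adj3 (G : graph) (x a b c : G) : cubic G ->
  a != b -> a != c -> b != c -> adj x a -> adj x b -> adj x c ->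
  forall z, adj x z = [|| z == a, z == b | z == c].
Proof.
move=> cubicG ab ac bc xa xb xc z.
have /setP/(_ z) : [set a; b; c] = [set y | adj x y].
  apply/eqP; rewrite eqEcard; apply/andP; split.
    by apply/subsetP => y; rewrite !inE -orbA => /or3P[]/eqP->.
  by rewrite (cubicG x) setUC cardsU1 cards2 !inE negb_or ab ![c == _]eq_sym ac bc.
by rewrite !inE -orbA => <-.
Qed.

Lemma cubic_adj (G : graph) (x y : G) : cubic G -> adj x y ->
  exists t1 t2, [/\ t1 != t2, t1 != y, t2 != y &
    forall z, adj x z = [|| z == y, z == t1 | z == t2]].
Proof.
move=> cubicG xy; have := cubicG x; rewrite (cardsD1 y) inE xy => -[] /eqP.
case/cards2P=> t1 [t2 [t12 eqt]]; exists t1, t2.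
have [t1y xt1] : t1 != y /\ adj x t1.
  by apply/andP; have := set21 t1 t2; rewrite -eqt !inE.
have [t2y xt2] : t2 != y /\ adj x t2.
  by apply/andP; have := set22 t1 t2; rewrite -eqt !inE.
by split=> //; apply: cubic_adj3; rewrite // eq_sym.
Qed.

(** Translates the cardinalities behind the Kászonyi numbers into flow counts on [G] minus the edge
    [e], the form in which the three graphs are compared. *)
Lemma card_ED_reduction (G : graph) (e : {set G}) : cubic G -> e \in edges G ->
  (forall z, z \in e -> forall a b, adj z a -> adj z b -> ~~ adj a b) ->
  6 * #|ED (edge_reduction e)| = nflows (edges G :\ e) (fun _ => 0%R).
Proof.
move=> cubicG /edgesP[x [y [xy ->]]] notri.
have [t1 [t2 [t12 t1y t2y adjx]]] := cubic_adj cubicG xy.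
rewrite adj_sym in xy; have [w1 [w2 [w12 w1x w2x adjy]]] := cubic_adj cubicG xy.
have trix := notri _ (set21 x y); have triy := notri _ (set22 x y).
rewrite card_ED.
- exact: (nflows_edge_reduction t12 t1y t2y w12 w1x w2x adjx adjy trix triy).
- have w1e : w1 \notin [set x; y].
    rewrite !inE negb_or w1x; have : adj y w1 by rewrite adjy eqxx orbT.
    by apply: contraTneq => ->; rewrite adj_irr.
  by apply/card_gt0P; exists (Sub w1 w1e).
- exact: (cubic_edge_reduction t12 t1y t2y w12 w1x w2x adjx adjy trix triy).
Qed.

(** * Splitting off a list of edges *)

Fixpoint nzsums (T : finType) (L : seq {set T}) (F : (T -> color) -> nat) d :=
  if L is S0 :: L' then nzsum (fun t => nzsums L' F (shift d S0 t)) else F d.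

Definition addL (T : finType) (L : seq {set T}) (E : {set {set T}}) :=
  foldr (fun S E' => S |: E') E L.

Lemma in_addL (T : finType) (L : seq {set T}) (E : {set {set T}}) S :
  (S \in addL L E) = (S \in L) || (S \in E).
Proof. by elim: L => //= S' L IHL; rewrite !inE IHL orbA. Qed.

Lemma addLD1 (T : finType) (L : seq {set T}) (E : {set {set T}}) S :
  S \notin L -> addL L E :\ S = addL L (E :\ S).
Proof.
move=> SL; apply/setP => S'; rewrite in_setD1 !in_addL in_setD1.
by have [->|//] := eqVneq S' S; rewrite (negPf SL).
Qed.

Lemma imset_setD1 (X Y : finType) (f : X -> Y) (A : {set X}) x :
  injective f -> f @: A :\ f x = f @: (A :\ x).
Proof.
move=> injf; apply/setP => y; rewrite in_setD1; apply/andP/imsetP.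
  by case=> yfx /imsetP[x' x'A eqy]; exists x';
    rewrite // in_setD1 x'A andbT -(inj_eq injf) -eqy.
by case=> x'; rewrite in_setD1 => /andP[x'x x'A] ->; rewrite (inj_eq injf) imset_f.
Qed.

(** Iterates [nflowsU1]. For a concrete list, [nzsums] unfolds by computation to nested sums in the
    order of the list. *)
Lemma nflows_addL (T : finType) (L : seq {set T}) (E : {set {set T}}) d :
  uniq L -> all (fun S => S \notin E) L ->
  nflows (addL L E) d = nzsums L (nflows E) d.
Proof.
elim: L d => //= S L IHL d /andP[SL uL] /andP[SE LE].
rewrite nflowsU1; last by rewrite in_addL negb_or SL.
by apply: eq_nzsum => t _; apply: IHL.
Qed.

Lemma degree_addL (T : finType) (L : seq {set T}) (E : {set {set T}}) x :
  uniq L -> all (fun S => S \notin E) L ->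
  degree (addL L E) x = count (fun S : {set T} => x \in S) L + degree E x.
Proof.
elim: L => //= S L IHL /andP[SL uL] /andP[SE LE].
by rewrite degreeU1 ?in_addL ?negb_or ?SL // IHL // addnA.
Qed.

(** * The four-pole of [G'] *)

Section PrimePole.
Variables (G : graph) (U V : G).
Local Notation A := (del_vertices [set U; V]).
Variables T1 T2 W1 W2 : A.
Hypotheses (T12 : T1 != T2) (W12 : W1 != W2).
Hypothesis adjU : forall z, adj U z = [|| z == V, z == val T1 | z == val T2].
Hypothesis adjV : forall z, adj V z = [|| z == U, z == val W1 | z == val W2].
Hypotheses (triangle_U : forall a b, adj U a -> adj U b -> ~~ adj a b).
Hypotheses (triangle_V : forall a b, adj V a -> adj V b -> ~~ adj a b).
Hypothesis uncolorable : nflows (edges G) (fun _ => 0%R) = 0.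

Local Notation P := (pole (edges A) T1 T2 W1 W2).

Let UV : U != V.
Proof.
have : adj U V by rewrite adjU eqxx.
by apply: contraTneq => ->; rewrite adj_irr.
Qed.
Let notU (a : A) : val a != U.
Proof. by have := valP a; rewrite !inE negb_or => /andP[]. Qed.
Let notV (a : A) : val a != V.
Proof. by have := valP a; rewrite !inE negb_or => /andP[]. Qed.
Let TW a b : adj U (val a) -> adj V (val b) -> a != b :> A.
Proof.
move=> Ua Vb; apply: contraTneq Vb => <-.
by apply: triangle_U; rewrite // adjU eqxx.
Qed.
Let UT1 : adj U (val T1). Proof. by rewrite adjU eqxx !orbT. Qed.
Let UT2 : adj U (val T2). Proof. by rewrite adjU eqxx !orbT. Qed.
Let VW1 : adj V (val W1). Proof. by rewrite adjV eqxx !orbT. Qed.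
Let VW2 : adj V (val W2). Proof. by rewrite adjV eqxx !orbT. Qed.

Let eqU (a : A) : (val a == U) = false. Proof. by rewrite (negPf (notU a)). Qed.
Let eqV (a : A) : (val a == V) = false. Proof. by rewrite (negPf (notV a)). Qed.
Let eqU' (a : A) : (U == val a) = false. Proof. by rewrite eq_sym (negPf (notU a)).
  Qed.
Let eqV' (a : A) : (V == val a) = false. Proof. by rewrite eq_sym (negPf (notV a)).
  Qed.
Let eqE := (eqU, eqV, eqU', eqV').

Definition prime_edges : seq {set G} :=
  [:: [set U; V]; [set U; val T1]; [set U; val T2]; [set V; val W1]; [set V;
    val W2]].

Lemma edges_prime : edges G = addL prime_edges (edges_off [set U; V]).
Proof. exact: edges_around. Qed.

Lemma uniq_prime_edges : uniq prime_edges.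
Proof.
rewrite /= !inE !eq_set2 !eqxx !eqE (negPf UV) !val_eqE (negPf T12) (negPf W12).
by rewrite eq_sym (negPf UV).
Qed.

Lemma prime_edges_notin : all (fun S => S \notin edges_off [set U; V]) prime_edges.
Proof. by rewrite /= !inE !disjoint_set2 !set21 !set22 !andbF. Qed.

Lemma degree_prime (a : A) : degree (edges G) (val a) =
  count (fun z : A => a == z) [:: T1; T2; W1; W2] + degree (edges A) a.
Proof.
rewrite edges_prime degree_addL ?uniq_prime_edges ?prime_edges_notin //.
rewrite -edges_del_vertices degree_imset; last exact: val_inj.
by rewrite /= !inE !eqE !val_eqE.
Qed.

(** By [handshake] the four demands add up to 0. *)
Lemma pole_parity t1 t2 w1 w2 :
  P t1 t2 w1 w2 != 0 -> (t1 + t2 = w1 + w2)%R.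
Proof.
move/(handshake (@card_edge A)); rewrite /demand4 !big_split /=.
have sum_pt (t : color) z : (\sum_v t *+ (v == z) = t)%R.
  by rewrite (bigD1 z) //= eqxx big1 ?addr0 // => v /negPf->; rewrite mulr0n.
by rewrite !sum_pt -addrA => /eqP; rewrite addc_eq0 => /eqP.
Qed.

Lemma pole_balanced t1 t2 w1 w2 :
  t1 != 0%R -> t2 != 0%R -> w1 != 0%R -> w2 != 0%R ->
  P t1 t2 w1 w2 != 0 -> t1 = t2 /\ w1 = w2.
Proof.
move=> n1 n2 n3 n4 P0; have tw := pole_parity P0.
have [t12|t12] := eqVneq t1 t2.
  split=> //; apply/eqP; rewrite -addc_eq0 -tw t12 addcc eqxx //.
(* Giving the edge between [U] and [V] the colour [t1 + t2], which equals [w1 + w2], balances both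
   ends. As this colour is nonzero, a flow of the pole would extend to a colouring of the
   uncolourable graph. *)
have ns : (t1 + t2 != 0)%R by rewrite addc_eq0.
case/eqP: P0; move: uncolorable.
rewrite edges_prime nflows_addL ?uniq_prime_edges ?prime_edges_notin //.
move=> /= /nzsum_eq0/(_ ns)/nzsum_eq0/(_ n1)/nzsum_eq0/(_ n2)/nzsum_eq0/(_
  n3)/nzsum_eq0/(_ n4).
rewrite -edges_del_vertices nflows_imset; last exact: val_inj.
move/eqP; rewrite muln_eq0 => /orP[/eqP P0|].
  rewrite -[RHS]P0; apply: eq_nflows => v.
  by rewrite /= /shift /demand4 !inE !eqE !val_eqE /= mulr0n !add0r.
rewrite eqb0 => /negP[]; apply/forallP => z; apply/implyP => zA.
have : z \in [set U; V].
  by apply: contraR zA => zA; rewrite -[z](SubK A zA) codom_f.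
rewrite in_set2 => /orP[]/eqP->;
  rewrite /shift !inE !eqE !eqxx ?[V == U]eq_sym (negPf UV) /= ?mulr0n ?mulr1n
  ?addr0 ?add0r.
  by rewrite -addrA addcc.
by rewrite tw -addrA addcc.
Qed.

(** The [T]-colour is changed by [pole_const_l]; exchanging the roles of the two pairs of ports then
    lets the same lemma change the [W]-colour. *)
Lemma pole_const t w : t != 0%R -> w != 0%R ->
  P t t w w = P (true, true) (true, true) (true, true) (true, true).
Proof.
have [TW11 TW12 TW21 TW22] : [/\ T1 != W1, T1 != W2, T2 != W1 & T2 != W2].
  by split; apply: TW.
move=> nt nw; transitivity (P (true, true) (true, true) w w).
  by apply: (pole_const_l (@card_edge A)) => //; apply: pole_balanced.
have swapP t1 t2 w1 w2 : P t1 t2 w1 w2 = pole (edges A) W1 W2 T1 T2 w1 w2 t1 t2.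
  by apply: eq_nflows => v; rewrite /demand4 -!addrA [RHS]addrA [RHS]addrC -!addrA.
rewrite !swapP; apply: (pole_const_l (@card_edge A)) => //; rewrite 1?eq_sym //.
by move=> t1 t2 w1 w2 *; have [] := @pole_balanced w1 w2 t1 t2; rewrite ?swapP.
Qed.

(** The two joining edges take any of the 3 * 3 pairs of colours, and each pair leaves the same
    number of flows on the pole. *)
Lemma nflows_prime : nflows (edges G :\ [set U; V]) (fun _ => 0%R) =
  9 * P (true, true) (true, true) (true, true) (true, true).
Proof.
rewrite (@nflows_del_edge_sum G U V (val T1) (val T2) (val W1) (val W2)) //.
have -> : 9 * P (true, true) (true, true) (true, true) (true, true) =
    nzsum (fun _ => nzsum (fun _ => P (true, true) (true, true) (true, true) (true,
      true))).
  by rewrite /nzsum !mulSn mul0n addn0 !addnA.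
apply: eq_nzsum => w nw; apply: eq_nzsum => t nt; rewrite -(pole_const nt nw).
rewrite -edges_del_vertices nflows_imset; last exact: val_inj.
rewrite (_ : [forall _, _] = true) ?muln1.
  apply: eq_nflows => v; rewrite /= /shift !mulrb_set2 ?val_eqE //.
  by rewrite ?val_eqE add0r addrC addrA.
apply/forallP => z; apply/implyP => zA.
have : z \in [set U; V] by apply: contraR zA => zA; rewrite -[z](SubK A zA) codom_f.
by rewrite in_set2 /shift => /orP[]/eqP->; rewrite !mulrb_set2 ?val_eqE // !eqE.
Qed.

End PrimePole.

(** * The glued graph *)

Lemma degreeU_isolated (T : finType) (E F : {set {set T}}) x :
  (forall S, S \in F -> x \notin S) -> degree (E :|: F) x = degree E x.
Proof.
move=> Fx; apply: eq_card => S; rewrite !inE andb_orl.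
by have [/Fx/negPf->|_] := boolP (S \in F); rewrite /= ?andbF ?orbF.
Qed.

(** Reduces distinctness of edges to comparisons of their ends, which compute for the new edges of
    the glued graph. *)
Lemma uniq_set2s (T : finType) (s : seq (T * T)) :
  uniq [seq [set p.1; p.2] | p <- s] = pairwise (fun p q =>
    ~~ ((p.1 == q.1) && (p.2 == q.2) || (p.1 == q.2) && (p.2 == q.1))) s.
Proof.
rewrite uniq_pairwise pairwise_map; apply: eq_pairwise => p q /=.
by rewrite eq_set2.
Qed.

Definition i0 : 'I_3 := @Ordinal 3 0 isT.
Definition i1 : 'I_3 := @Ordinal 3 1 isT.
Definition i2 : 'I_3 := @Ordinal 3 2 isT.

Lemma I3P (i : 'I_3) : [\/ i = i0, i = i1 | i = i2].
Proof.
case: i => [[|[|[|//]]] lt_i]; [constructor 1|constructor 2|constructor 3];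
  exact: val_inj.
Qed.

Section GlueEdges.
Variables (G' Gs : graph) (U V : G') (u v : Gs).
Local Notation A := (del_vertices [set U; V]).
Local Notation B := (del_vertices [set u; v]).
Variables (Tm2 T2 Wm2 W2 : A) (u_ v_ : 'I_3 -> B).
Local Notation GG := (glue U V u v Tm2 T2 Wm2 W2 (val \o u_) (val \o v_)).

Local Notation pr a := (inl (inl a) : GG).
Local Notation st a := (inl (inr a) : GG).
Local Notation tt i := (inr (inl i) : GG).
Local Notation ww i := (inr (inr i) : GG).

(** Each first entry is a new vertex, whence [new_edges_inr]. The order is six spokes to [Gs], then
    the path of the [T_i], then that of the [W_i]; it fixes the order of the nested sums in
    [nflows_glue]. *)
Definition new_pairs : seq (GG * GG) :=
  [:: (tt i0, st (u_ i0)); (tt i1, st (u_ i1)); (tt i2, st (u_ i2));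
      (ww i0, st (v_ i0)); (ww i1, st (v_ i1)); (ww i2, st (v_ i2));
      (tt i0, pr Tm2); (tt i0, tt i1); (tt i1, tt i2); (tt i2, pr T2);
      (ww i0, pr Wm2); (ww i0, ww i1); (ww i1, ww i2); (ww i2, pr W2)].

Definition new_edges : seq {set GG} := [seq [set p.1; p.2] | p <- new_pairs].

Definition old_edges (E : {set {set A}}) (F : {set {set B}}) : {set {set GG}} :=
  [set (fun a => pr a) @: S | S : {set A} in E] :|:
  [set (fun a => st a) @: S | S : {set B} in F].

Lemma uniq_new_edges : uniq new_edges.
Proof.
by rewrite uniq_set2s.
Qed.

Lemma mem_new_edges k : k < 14 -> nth set0 new_edges k \in new_edges.
Proof. by move=> lt_k; apply: mem_nth. Qed.

Lemma new_pairs_adj : all (fun p => adj p.1 p.2) new_pairs.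
Proof. by rewrite /= /glue_adj /= !eqxx !orbT. Qed.

Lemma new_edges_inr S : S \in new_edges -> exists i, inr i \in S.
Proof.
have : all (fun p : GG * GG => if p.1 is inr _ then true else false) new_pairs by
  [].
move=> /allP inrP /mapP[[p q] /inrP]; case: p => // i _ ->.
by exists i; apply: set21.
Qed.

Lemma edges_glue :
  edges GG = addL new_edges (old_edges (edges A) (edges B)).
Proof.
have arcE p q : glue_arc Tm2 T2 Wm2 W2 (val \o u_) (val \o v_) p q ->
    [set p; q] \in addL new_edges (old_edges (edges A) (edges B)).
  have newP k : k < 14 -> nth set0 new_edges k \in addL new_edges (old_edges (edges
    A) (edges B)).
    by move=> lt_k; rewrite in_addL mem_new_edges.
  case: p q => [[a|a]|[i|i]] [[b|b]|[j|j]];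
    rewrite [glue_arc _ _ _ _ _ _ _ _]/= => //.
  - move=> ab; rewrite in_addL in_setU; apply/orP; right; apply/orP; left.
    by apply/imset_edgesP; exists a, b.
  - case/orP=> /andP[/eqP-> /eqP ji]; rewrite setUC.
      by rewrite (_ : j = i0); [exact: (newP 6)|apply: val_inj].
    by rewrite (_ : j = i2); [exact: (newP 9)|apply: val_inj].
  - case/orP=> /andP[/eqP-> /eqP ji]; rewrite setUC.
      by rewrite (_ : j = i0); [exact: (newP 10)|apply: val_inj].
    by rewrite (_ : j = i2); [exact: (newP 13)|apply: val_inj].
  - move=> ab; rewrite in_addL in_setU; apply/orP; right; apply/orP; right.
    by apply/imset_edgesP; exists a, b.
  - move=> /eqP/val_inj->; case: (I3P i) => ->.
    + exact: (newP 0).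
    + exact: (newP 1).
    + exact: (newP 2).
  - case: (I3P i) => ->; case: (I3P j) => -> // _.
    + exact: (newP 7).
    + exact: (newP 8).
  - move=> /eqP/val_inj->; case: (I3P i) => ->.
    + exact: (newP 3).
    + exact: (newP 4).
    + exact: (newP 5).
  - case: (I3P i) => ->; case: (I3P j) => -> // _.
    + exact: (newP 11).
    + exact: (newP 12).
apply/setP => S; apply/idP/idP => [/edgesP[p [q [/orP[|] pq ->]]]|];
  first exact: arcE.
  by rewrite (setUC [set p]); apply: arcE.
rewrite in_addL => /orP[/mapP[p pL ->]|].
  by rewrite mem_edges; apply: (allP new_pairs_adj).
rewrite in_setU => /orP[]/imset_edgesP[a [b [ab ->]]]; rewrite mem_edges;
  by apply/orP; left.
Qed.

Lemma old_edges_inr E F i S : S \in old_edges E F -> inr i \notin S.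
Proof.
by rewrite in_setU => /orP[]/imsetP[S' _ ->]; apply/negP => /imsetP[].
Qed.

Lemma new_edges_notin E F : all (fun S => S \notin old_edges E F) new_edges.
Proof.
apply/allP => S SL; apply/negP => SE.
by have [i] := new_edges_inr SL; apply/negP/(old_edges_inr _ SE).
Qed.

(** Exhibits the old edges as a sum in two levels, with no edges on the six new vertices, which is
    the shape that [nflows_sum] takes apart. *)
Lemma old_edgesE E F : old_edges E F =
  [set inl @: S | S : {set A + B} in
     [set inl @: S | S : {set A} in E] :|: [set inr @: S | S : {set B} in F]] :|:
  [set inr @: S | S : {set ('I_3 + 'I_3)%type} in set0].
Proof.
rewrite imset0 setU0 imsetU /old_edges; congr (_ :|: _); rewrite -imset_comp;
  by apply: eq_imset => S /=; rewrite -imset_comp.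
Qed.

Lemma old_edgesD1 (E : {set {set A}}) (F : {set {set B}}) (e : {set B}) : e != set0
  ->
  old_edges E F :\ ((fun b => st b) @: e) = old_edges E (F :\ e).
Proof.
case/set0Pn => b be; rewrite /old_edges setDUl.
have st_inj : injective (fun b => st b) by move=> ? ? [].
rewrite (imset_setD1 _ _ (imset_inj st_inj)); congr (_ :|: _).
apply/setDidPl; rewrite disjoint_sym disjoints1.
apply/imsetP => -[S _ /setP/(_ (st b))].
by rewrite (mem_imset _ _ st_inj) be => /esym/imsetP[].
Qed.

Lemma nflows_old_edges (E : {set {set A}}) (F : {set {set B}}) d : set0 \notin E ->
  set0 \notin F ->
  nflows (old_edges E F) d =
  nflows E (fun a => d (pr a)) * nflows F (fun a => d (st a)) *
  [forall i, d (inr i) == 0%R].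
Proof.
move=> E0 F0; rewrite old_edgesE nflows_sum; last first.
  rewrite in_setU; apply/negP => /orP[]/imsetP[S SE /esym/eqP].
    by rewrite imset_eq0 => /eqP S0; rewrite S0 in SE; rewrite SE in E0.
  by rewrite imset_eq0 => /eqP S0; rewrite S0 in SE; rewrite SE in F0.
by rewrite nflows_sum // nflows0.
Qed.

End GlueEdges.

(** The terms are added rather than chosen by cases, because some [u_ i] may coincide with some
    [v_ j], and then both demands fall on the same vertex. *)
Definition demand6 (T : finType) (a b c a' b' c' : T) (p q r p' q' r' : color) : T
  -> color :=
  fun v => (p *+ (v == a) + q *+ (v == b) + r *+ (v == c) +
    p' *+ (v == a') + q' *+ (v == b') + r' *+ (v == c'))%R.

(** * The surroundings of [u] and [v] *)

Section Star.
Variables (G : graph) (u v : G).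
Local Notation B := (del_vertices [set u; v]).
Variables (u_ v_ : 'I_3 -> B) (e : {set B}).
Hypotheses (uv : u != v) (u_inj : injective u_) (v_inj : injective v_).
Hypothesis adju : forall z, adj u z = [|| z == val (u_ i0),
  z == val (u_ i1) | z == val (u_ i2)].
Hypothesis adjv : forall z, adj v z = [|| z == val (v_ i0),
  z == val (v_ i1) | z == val (v_ i2)].
Hypothesis eB : e \in edges B.

Definition star_edges : seq {set G} :=
  [:: [set u; val (u_ i0)]; [set u; val (u_ i1)]; [set u; val (u_ i2)];
      [set v; val (v_ i0)]; [set v; val (v_ i1)]; [set v; val (v_ i2)]].

Lemma edges_star : edges G = addL star_edges (edges_off [set u; v]).
Proof.
apply/setP => S; rewrite in_addL !inE; apply/idP/idP.
  move=> SE; have [uS|uS] := boolP (u \in S).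
    by have [z] := edges_at SE uS; rewrite adju => /or3P[]/eqP-> ->;
      rewrite eqxx ?orbT.
  have [vS|vS] := boolP (v \in S).
    by have [z] := edges_at SE vS; rewrite adjv => /or3P[]/eqP-> ->;
      rewrite ?eqxx ?orbT.
  by rewrite SE disjoint_sym disjoint_set2 uS vS !orbT.
rewrite -!orbA.
do 6 (case/orP=> [/eqP->|]; first by rewrite mem_edges ?adju ?adjv eqxx ?orbT).
by move=> /andP[].
Qed.

Let eqE : ((forall a : B, (val a == u) = false) * (forall a : B,
  (val a == v) = false))%type.
Proof.
by split=> a; have := valP a; rewrite !inE negb_or => /andP[/negPf au /negPf av].
Qed.
Let eqE' : ((forall a : B, (u == val a) = false) * (forall a : B,
  (v == val a) = false))%type.
Proof. by split=> a; rewrite eq_sym eqE. Qed.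

Let offB z : z \in [set u; v] -> z \notin codom (val : B -> G).
Proof.
by move=> zuv; apply/codomP => -[[a aB] /= za]; move: aB; rewrite -za zuv.
Qed.

Lemma uniq_star_edges : uniq star_edges.
Proof.
rewrite /= !inE !eq_set2 !eqxx !(eqE, eqE') (negPf uv) !val_eqE.
by rewrite !(inj_eq u_inj) !(inj_eq v_inj).
Qed.

Lemma star_edges_notin (E : {set {set G}}) : E \subset edges_off [set u; v] ->
  all (fun S => S \notin E) star_edges.
Proof.
move=> /subsetP sE; apply/allP => S SL; apply/negP => /sE.
by move: SL; rewrite !inE; do ! (case/orP=> [/eqP->|]); last move/eqP->;
  rewrite disjoint_set2 ?set21 ?set22 ?andbF.
Qed.

Lemma edges_star_del : edges G :\ (val @: e) =
  addL star_edges [set val @: S | S : {set B} in edges B :\ e].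
Proof.
rewrite edges_star addLD1 -?edges_del_vertices ?imset_setD1 //.
  exact/imset_inj/val_inj.
have veE : val @: e \in edges_off [set u; v].
  by rewrite -edges_del_vertices imset_f.
by apply: contraL veE; apply: (allP (star_edges_notin (subxx _))).
Qed.

(** Splitting off the six edges at [u] and [v] leaves these two vertices isolated, so the colours
    arriving at each must add up to 0. *)
Lemma nflows_star : nflows (edges G :\ (val @: e)) (fun _ => 0%R) =
  nzsum (fun p => nzsum (fun q => nzsum (fun r =>
  nzsum (fun p' => nzsum (fun q' => nzsum (fun r' =>
    nflows (edges B :\ e) (demand6 (u_ i0) (u_ i1) (u_ i2) (v_ i0) (v_ i1) (v_ i2)
      p q r p' q' r') *
    ((p + q + r == 0)%R && (p' + q' + r' == 0)%R))))))).
Proof.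
rewrite edges_star_del nflows_addL ?uniq_star_edges //; last first.
  apply: star_edges_notin; rewrite -edges_del_vertices.
  by apply: imsetS; apply: subsetDl.
rewrite /=; do 6 apply: eq_nzsum => ? _.
rewrite nflows_imset; last exact: val_inj.
congr (_ * nat_of_bool _).
  apply: eq_nflows => a; rewrite /= /shift /demand6 !inE !(eqE, eqE') !val_eqE /=.
  by rewrite add0r.
apply/forallP/andP => [d0|[/eqP pqr /eqP pqr'] z].
  split.
    have := d0 u; rewrite /shift !inE !(eqE,
      eqE') eqxx (negPf uv) /= !mulr0n !mulr1n !addr0 add0r.
    by move/implyP; apply; apply: offB; rewrite set21.
  have := d0 v; rewrite /shift !inE !(eqE,
    eqE') eqxx [v == u]eq_sym (negPf uv) /= !mulr0n !mulr1n !add0r.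
  by move/implyP; apply; apply: offB; rewrite set22.
apply/implyP => zB.
have : z \in [set u; v] by apply: contraR zB => zB; rewrite -[z](SubK B zB) codom_f.
rewrite in_set2 /shift => /orP[]/eqP->; rewrite !inE !(eqE, eqE') eqxx.
  by rewrite (negPf uv) /= !mulr0n !mulr1n !addr0 add0r pqr.
by rewrite [v == u]eq_sym (negPf uv) /= !mulr0n !mulr1n !add0r pqr'.
Qed.

Lemma degree_star b : degree (edges G) (val b) =
  count (fun z : B => b == z) [:: u_ i0; u_ i1; u_ i2; v_ i0; v_ i1;
    v_ i2] + degree (edges B) b.
Proof.
rewrite edges_star degree_addL ?uniq_star_edges ?star_edges_notin //.
rewrite -edges_del_vertices degree_imset; last exact: val_inj.
by rewrite /= !inE !eqE !val_eqE.
Qed.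

End Star.

(** Balance at the three vertices of a new path: [p], [q], [r] come from the spokes, [x], [y] from
    the two inner edges, and [t], [t'] from the edges at the ends. *)
Definition side (p q r t x y t' : color) : bool :=
  [&& p + t + x == 0, q + x + y == 0 & r + y + t' == 0]%R.

(** * Flows on the glued graph *)

Section Glue.
Variables (G' Gs : graph) (U V : G') (u v : Gs).
Local Notation A := (del_vertices [set U; V]).
Local Notation B := (del_vertices [set u; v]).
Variables (Tm2 T2 Wm2 W2 : A) (u_ v_ : 'I_3 -> B) (e : {set B}).
Local Notation GG := (glue U V u v Tm2 T2 Wm2 W2 (val \o u_) (val \o v_)).
Local Notation st := (fun a : B => inl (inr a) : GG).
Local Notation eG := (st @: e).
Local Notation L := (new_edges Tm2 T2 Wm2 W2 u_ v_).
Local Notation old := (old_edges Tm2 T2 Wm2 W2 u_ v_).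
Hypothesis eB : e \in edges B.

Lemma mem_glue_edge : eG \in edges GG.
Proof.
case/edgesP: eB => a [b [ab ->]]; apply/edgesP.
exists (st a), (st b); rewrite imset_set2; split=> //.
by apply/orP; left.
Qed.

Lemma edges_glue_del :
  edges GG :\ eG = addL L (old (edges A) (edges B :\ e)).
Proof.
have e0 : e != set0 by rewrite -card_gt0 (card_edge eB).
have eL : eG \notin L.
  by apply/negP => /new_edges_inr[i] /imsetP[].
by rewrite (edges_glue Tm2 T2 Wm2 W2 u_ v_) (addLD1 _ eL) (old_edgesD1 _ _ _ _ _ _
  _ _ e0).
Qed.

(** Without the fourteen new edges the graph falls apart into the pole, the remainder of [Gs], and
    six isolated vertices; the vanishing of the demands on the latter is expressed by the two [side]
    conditions. *)
Lemma nflows_glue : nflows (edges GG :\ eG) (fun _ => 0%R) =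
  nzsum (fun p => nzsum (fun q => nzsum (fun r =>
  nzsum (fun p' => nzsum (fun q' => nzsum (fun r' =>
  nzsum (fun t1 => nzsum (fun x => nzsum (fun y => nzsum (fun t2 =>
  nzsum (fun w1 => nzsum (fun x' => nzsum (fun y' => nzsum (fun w2 =>
    pole (edges A) Tm2 T2 Wm2 W2 t1 t2 w1 w2 *
    nflows (edges B :\ e) (demand6 (u_ i0) (u_ i1) (u_ i2) (v_ i0) (v_ i1) (v_ i2)
      p q r p' q' r') *
    (side p q r t1 x y t2 && side p' q' r' w1 x' y' w2))))))))))))))).
Proof.
rewrite edges_glue_del nflows_addL ?uniq_new_edges ?new_edges_notin //.
rewrite [LHS]/=.
apply: eq_nzsum => p _; apply: eq_nzsum => q _; apply: eq_nzsum => r _.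
apply: eq_nzsum => p' _; apply: eq_nzsum => q' _; apply: eq_nzsum => r' _.
apply: eq_nzsum => t1 _; apply: eq_nzsum => x _; apply: eq_nzsum => y _.
apply: eq_nzsum => t2 _; apply: eq_nzsum => w1 _; apply: eq_nzsum => x' _.
apply: eq_nzsum => y' _; apply: eq_nzsum => w2 _.
rewrite nflows_old_edges; first last.
- by apply/negP; rewrite in_setD1 => /andP[_]; apply/negP/set0_edges.
- exact: set0_edges.
congr (_ * _ * nat_of_bool _).
- apply: eq_nflows => a; rewrite /shift /demand4 !in_set2 /=.
  by rewrite !mulr0n !addr0 !add0r.
- apply: eq_nflows => a; rewrite /shift /demand6 !in_set2 /=.
  by rewrite !mulr0n !addr0 !add0r.
apply/forallP/andP => [d0|[/and3P[/eqP s0 /eqP s1 /eqP s2] /and3P[/eqP s0' /eqP s1'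
  /eqP s2']]].
  have dT i := eqP (d0 (inl i)); have dW i := eqP (d0 (inr i)).
  move: (dT i0) (dT i1) (dT i2) (dW i0) (dW i1) (dW i2).
  rewrite /shift !in_set2 /= ?mulr0n ?mulr1n ?addr0 ?add0r.
  by move=> T0 T1 T2' W0 W1 W2'; rewrite /side T0 T1 T2' W0 W1 W2' !eqxx.
case=> i; case: (I3P i) => ->; rewrite /shift !in_set2 /=;
  by rewrite ?mulr0n ?mulr1n ?addr0 ?add0r ?s0 ?s1 ?s2 ?s0' ?s1' ?s2'.
Qed.

Lemma degree_glue_prime (a : A) : degree (edges GG) (inl (inl a) : GG) =
  count (fun z : A => a == z) [:: Tm2; T2; Wm2; W2] + degree (edges A) a.
Proof.
rewrite (edges_glue Tm2 T2 Wm2 W2 u_ v_) degree_addL ?uniq_new_edges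
  ?new_edges_notin //.
congr (_ + _); first by rewrite count_map /= !in_set2.
rewrite degreeU_isolated ?degree_imset // => [x y []//|S].
by case/imsetP=> S' _ ->; apply/imsetP => -[].
Qed.

Lemma degree_glue_star (b : B) : degree (edges GG) (st b) =
  count (fun z : B => b == z) [:: u_ i0; u_ i1; u_ i2; v_ i0; v_ i1; v_ i2] +
  degree (edges B) b.
Proof.
rewrite (edges_glue Tm2 T2 Wm2 W2 u_ v_) degree_addL ?uniq_new_edges
  ?new_edges_notin //.
congr (_ + _); first by rewrite count_map /= !in_set2.
rewrite [X in degree X _]setUC degreeU_isolated ?degree_imset // => [x y []//|S].
by case/imsetP=> S' _ ->; apply/imsetP => -[].
Qed.

Lemma degree_glue_new i : degree (edges GG) (inr i : GG) = 3.
Proof.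
rewrite (edges_glue Tm2 T2 Wm2 W2 u_ v_) degree_addL ?uniq_new_edges
  ?new_edges_notin //.
rewrite degree_isolated ?addn0 ?count_map => [|S]; last exact: old_edges_inr.
by case: i => i; case: (I3P i) => ->; rewrite /= !in_set2.
Qed.

(** A neighbour of [z] is an old neighbour or a new vertex attached at [z]. Two old ones are settled
    by the hypothesis on [Gs]; an old one adjacent to such a new vertex would be [z] itself; two new
    ones are equal or lie on different paths. *)
Lemma triangle_free_glue (z : B) (p q : GG) : injective u_ -> injective v_ ->
  (forall x y z : Gs, adj x y -> adj x z -> ~~ adj y z) ->
  adj (st z : GG) p -> adj (st z : GG) q -> ~~ adj p q.
Proof.
move=> u_inj v_inj notri.
have arcE p' : adj (st z : GG) p' -> match p' with
    | inl (inl _) => False | inl (inr b) => adj (val z) (val b)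
    | inr (inl i) => z = u_ i | inr (inr i) => z = v_ i end.
  case: p' => [[a|b]|[i|i]] /orP[] //=; rewrite /del_vertices_adj 1?adj_sym //;
    by move=> /eqP/val_inj.
move=> /arcE zp /arcE zq; apply/negP => pq.
case: p q zp zq pq => [[a|b]|[i|i]] [[a'|b']|[j|j]] //=.
- move=> zb zb'; have /negP nbb' := notri _ _ _ zb zb'.
  by case/orP=> [/nbb'//|]; rewrite /= /del_vertices_adj adj_sym => /nbb'.
- by move=> zb zj /orP[|] // /eqP/val_inj bj; rewrite zj -bj adj_irr in zb.
- by move=> zb zj /orP[|] // /eqP/val_inj bj; rewrite zj -bj adj_irr in zb.
- by move=> zi zb /orP[|] // /eqP/val_inj bi; rewrite zi -bi adj_irr in zb.
- by move=> -> /u_inj->; rewrite /glue_adj orbb /= gtn_eqF.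
- by move=> zi zb /orP[|] // /eqP/val_inj bi; rewrite zi -bi adj_irr in zb.
- by move=> -> /v_inj->; rewrite /glue_adj orbb /= gtn_eqF.
Qed.

End Glue.

(** Adding the three balance conditions with [t = t'] gives [p + q + r = 0]. Then [p], [q], [r] are
    distinct, and the only solution is [t = t' = q], [x = r], [y = p]. *)
Lemma side_count p q r : p != 0%R -> q != 0%R -> r != 0%R ->
  nzsum (fun t => nzsum (fun x => nzsum (fun y => nzsum (fun t' =>
    (t == t') * side p q r t x y t')))) = (p + q + r == 0)%R.
Proof. by case: p q r => [[] []] [[] []] [[] []]. Qed.

Definition nzsum4 (F : color -> color -> color -> color -> nat) : nat :=
  nzsum (fun t => nzsum (fun x => nzsum (fun y => nzsum (F t x y)))).

Lemma eq_nzsum4 F F' :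
  (forall t x y t', t != 0%R -> x != 0%R -> y != 0%R -> t' != 0%R ->
     F t x y t' = F' t x y t') -> nzsum4 F = nzsum4 F'.
Proof.
by move=> eqF; do 4 (apply: eq_nzsum => ? ?); apply: eqF.
Qed.

Lemma nzsum4_mull k F :
  nzsum4 (fun t x y t' => k * F t x y t') = k * nzsum4 F.
Proof. by do 4 (rewrite -nzsum_mull; apply: eq_nzsum => ? _). Qed.

(** Since [P] is [k] times a product of one condition for each path, the sums over the two paths
    separate, and [side_count] evaluates each. Here [n] stands for the flow count on the side of
    [Gs]. *)
Lemma sum_sides k n p q r p' q' r' (P : color -> color -> color -> color -> nat) :
  p != 0%R -> q != 0%R -> r != 0%R -> p' != 0%R -> q' != 0%R -> r' != 0%R ->
  (forall t t' w w', t != 0%R -> t' != 0%R -> w != 0%R -> w' != 0%R ->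
    P t t' w w' = k * ((t == t') * (w == w'))) ->
  nzsum4 (fun t x y t' => nzsum4 (fun w x' y' w' =>
    P t t' w w' * n * (side p q r t x y t' && side p' q' r' w x' y' w'))) =
  k * (n * ((p + q + r == 0)%R && (p' + q' + r' == 0)%R)).
Proof.
move=> np nq nr np' nq' nr' PE.
transitivity (nzsum4 (fun t x y t' => k * n * (p' + q' + r' == 0)%R *
    ((t == t') * side p q r t x y t'))).
  apply: eq_nzsum4 => t x y t' nt _ _ nt'.
  transitivity (nzsum4 (fun w x' y' w' =>
      k * n * ((t == t') * side p q r t x y t') * ((w == w') * side p' q' r' w x'
        y' w'))).
    apply: eq_nzsum4 => w x' y' w' nw _ _ nw'; rewrite PE // -mulnb.
    by rewrite -!mulnA; congr (_ * _); rewrite !mulnA; case: eqP; case: eqP;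
      rewrite ?muln0 ?mul0n ?mul1n ?muln1.
  by rewrite nzsum4_mull [nzsum4 _]side_count // mulnAC.
by rewrite nzsum4_mull [nzsum4 _]side_count // -mulnb mulnA [in RHS]mulnA mulnAC.
Qed.

(** * Comparing the three reductions *)

Lemma snark_triangle_free (G : graph) : snark G ->
  forall x y z : G, adj x y -> adj x z -> ~~ adj y z.
Proof.
case=> _ _ [g [_ gmin] g5] _ _ x y z xy xz; apply/negP => yz.
have neq a b : adj a b -> a != b by apply: contraTneq => ->; rewrite adj_irr.
have : is_cycle [:: x; y; z].
  by rewrite /is_cycle /ucycleb /= xy yz adj_sym xz !inE negb_or !neq.
by move/gmin => /= g3; have := leq_trans g5 g3.
Qed.

(** The claim with denominators cleared, so that it is an identity between natural numbers. *)
Lemma card_ED_glue (G' Gs : graph) (U V : G') (u v : Gs)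
    (Tm2 T2 Wm2 W2 : del_vertices [set U; V])
    (u_ v_ : 'I_3 -> del_vertices [set u; v])
    (e : {set del_vertices [set u; v]}) :
  snark G' -> adj U V ->
  Tm2 != T2 -> adj (val Tm2) U -> adj (val T2) U ->
  Wm2 != W2 -> adj V (val Wm2) -> adj V (val W2) ->
  snark Gs -> u != v ->
  injective u_ -> (forall i, adj u (val (u_ i))) ->
  injective v_ -> (forall i, adj (val (v_ i)) v) ->
  e \in edges (del_vertices [set u; v]) ->
  let G := glue U V u v Tm2 T2 Wm2 W2 (val \o u_) (val \o v_) in
  3 * #|ED (edge_reduction ([set in_star U V a | a in e] : {set G}))| =
  2 * (#|ED (edge_reduction [set val a | a in e])| *
       #|ED (edge_reduction [set U; V])|).
Proof.
move=> snG' UV T12 TU T2U W12 VW VW2 snGs uv u_inj uu v_inj vv eB G.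
have tri' := snark_triangle_free snG'; have tris := snark_triangle_free snGs.
have [_ cub' _ _ uncol'] := snG'; have [_ cubs _ _ _] := snGs.
have notUV (a : del_vertices [set U; V]) : val a != U /\ val a != V.
  by have := valP a; rewrite !inE negb_or => /andP.
have adjU z : adj U z = [|| z == V, z == val Tm2 | z == val T2].
  by apply: cubic_adj3; rewrite // 1?eq_sym ?(notUV _).2 // adj_sym.
have adjV z : adj V z = [|| z == U, z == val Wm2 | z == val W2].
  by apply: cubic_adj3; rewrite // 1?eq_sym ?(notUV _).1 // adj_sym.
have adju z : adj u z = [|| z == val (u_ i0), z == val (u_ i1) | z == val (u_ i2)].
  by apply: cubic_adj3; rewrite // val_eqE (inj_eq u_inj).
have adjv z : adj v z = [|| z == val (v_ i0), z == val (v_ i1) | z == val (v_ i2)].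
  by apply: cubic_adj3; rewrite // 1?val_eqE ?(inj_eq v_inj) // adj_sym.
have deg' := degree_prime T12 W12 adjU adjV.
have degs := degree_star uv u_inj v_inj adju adjv.
have cubG : cubic G.
  move=> x; rewrite -degree_edges; case: x => [[a|b]|i].
  - by rewrite degree_glue_prime -deg' degree_edges cub'.
  - by rewrite degree_glue_star -degs degree_edges cubs.
  - exact: degree_glue_new.
have esE : [set val a | a in e] \in edges Gs.
  have /(imset_f (fun S : {set _} => val @: S)) := eB.
  by rewrite edges_del_vertices inE => /andP[].
have UVE : [set U; V] \in edges G' by rewrite mem_edges.
have ED' := card_ED_reduction cub' UVE (fun z _ => tri' z).
have EDs := card_ED_reduction cubs esE (fun z _ => tris z).
have triG (z : G) : z \in ([set in_star U V a | a in e] : {set G}) ->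
    forall p q : G, adj z p -> adj z q -> ~~ adj p q.
  by case/imsetP=> b _ -> p q; apply: triangle_free_glue.
have EDG := card_ED_reduction cubG (mem_glue_edge Tm2 T2 Wm2 W2 u_ v_ eB) triG.
have unc := nflows_uncolorable cub' uncol'.
pose P := pole (edges (del_vertices [set U; V])) Tm2 T2 Wm2 W2.
set k := P (true, true) (true, true) (true, true) (true, true).
(* Unequal colours on one side give 0 by [pole_balanced]; all remaining values equal [k] by
   [pole_const]. *)
have PE t t' w w' : t != 0%R -> t' != 0%R -> w != 0%R -> w' != 0%R ->
    P t t' w w' = k * ((t == t') * (w == w')).
  move=> nt nt' nw nw'; have [P0|P0] := eqVneq (P t t' w w') 0.
    rewrite P0; have [tt'|] := eqVneq t t'; last by rewrite muln0.
    have [ww'|] := eqVneq w w'; last by rewrite !muln0.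
    by rewrite !muln1 -P0 -tt' -ww' /P (pole_const T12 W12 adjU adjV (tri' U)).
  have [<- <-] := pole_balanced T12 W12 adjU adjV unc nt nt' nw nw' P0.
  by rewrite !eqxx !muln1 /P (pole_const T12 W12 adjU adjV (tri' U)).
have NG : nflows (edges G :\ ([set in_star U V a | a in e] : {set G})) (fun=> 0%R) =
    k * nflows (edges Gs :\ [set val a | a in e]) (fun=> 0%R).
  rewrite (nflows_glue Tm2 T2 Wm2 W2 u_ v_ eB).
  rewrite (nflows_star uv u_inj v_inj adju adjv eB).
  do 6 (rewrite -nzsum_mull; apply: eq_nzsum => ? ?).
  exact: sum_sides.
have N' := nflows_prime T12 W12 adjU adjV (tri' U) (tri' V) unc.
(* The factor 18 makes all counts flow counts: 18 * 3 = 9 * 6 on the left, where the 9 joins [k] to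
   form the count of [G'], and 18 * 2 = 6 * 6 on the right. *)
apply/eqP; rewrite -(eqn_pmul2l (isT : 0 < 18)); apply/eqP.
transitivity (9 *
  (6 * #|ED (edge_reduction ([set in_star U V a | a in e] : {set G}))|)).
  by rewrite !mulnA.
rewrite EDG NG mulnA -N' -ED' -EDs.
by rewrite mulnACA [RHS]mulnA; congr (_ * _); apply: mulnC.
Qed.

Lemma kaszonyi_ratio (g a b : nat) : 3 * g = 2 * (a * b) ->
  (g%:R / 3%:R = 2%:R * (a%:R / 3%:R) * (b%:R / 3%:R) :> rat)%R.
Proof.
move=> /(congr1 (fun n => n%:R : rat)%R); rewrite !natrM => gab.
apply: (mulfI (_ : 3%:R != 0 :> rat)%R) => //; rewrite [LHS]mulrA gab.
by field.
Qed.

Theorem theorem5p3 (G' Gs : graph) (U V : G') (u v : Gs)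
    (Tm2 T2 Wm2 W2 : del_vertices [set U; V])
    (u_ v_ : 'I_3 -> Gs)
    (e : {set del_vertices [set u; v]}) :
  snark G' -> adj U V ->
  Tm2 != T2 -> adj (val Tm2) U -> adj (val T2) U ->
  Wm2 != W2 -> adj V (val Wm2) -> adj V (val W2) ->
  snark Gs -> u != v -> ~~ adj u v ->
  injective u_ -> (forall i, adj u (u_ i)) ->
  injective v_ -> (forall i, adj (v_ i) v) ->
  e \in edges (del_vertices [set u; v]) ->
  let G := glue U V u v Tm2 T2 Wm2 W2 u_ v_ in
  let eG : {set G} := [set in_star U V a | a in e] in
  let es : {set Gs} := [set val a | a in e] in
  eG \in edges G /\
  kaszonyi eG = (2%:R * kaszonyi es * kaszonyi [set U; V])%R.
Proof.
move=> snG' UV T12 TU T2U W12 VW VW2 snGs uv nuv u_inj uu v_inj vv eB.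
(* The neighbours of [u] survive the deletion: none is [u], and none is [v] as [u] and [v] are not
   adjacent. *)
have u_notin i : u_ i \notin [set u; v].
  rewrite !inE negb_or; apply/andP; split; apply: contraTneq (uu i) => ->.
    by rewrite adj_irr.
  exact: nuv.
have v_notin i : v_ i \notin [set u; v].
  rewrite !inE negb_or; apply/andP; split; apply: contraTneq (vv i) => ->.
    exact: nuv.
  by rewrite adj_irr.
(* Lifts to the vertices that remain; composing them with [val] gives back [u_] and [v_] by
   conversion, so the lemmas apply to the glued graph of the statement. *)
pose us i : del_vertices [set u; v] := exist _ (u_ i) (u_notin i).
pose vs i : del_vertices [set u; v] := exist _ (v_ i) (v_notin i).
have us_inj : injective us by move=> i j /(congr1 val)/u_inj.
have vs_inj : injective vs by move=> i j /(congr1 val)/v_inj.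
have cardE := @card_ED_glue G' Gs U V u v Tm2 T2 Wm2 W2 us vs e snG' UV T12 TU T2U
  W12 VW VW2 snGs uv us_inj uu vs_inj vv eB.
split; first exact: (mem_glue_edge Tm2 T2 Wm2 W2 us vs eB).
exact: kaszonyi_ratio cardE.
Qed.
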